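(* Let $K$ be an infinite field and let $R\cong \mathcal O_1\times\cdots\times\mathcal O_c$ be a direct product of local rings of plane algebroid curves over $K$, with $d$ branches in total and value semigroup $S=v(R)\subseteq\mathbb N^d$. Let $\omega=(\omega_1,\dots,\omega_d)\in S$ with $\omega_i>0$ for every $i$, put $N=\omega_1+\cdots+\omega_d$, and let $F\in R$ with $v(F)=\omega$. Let $A=S\setminus(\omega+S)=\bigcup_{i=0}^{N-1}A_i$ be the Apéry set of $S$ with respect to $\omega$, partitioned into its levels. Let $G\in R$, not divisible by $F$, be such that $$R=K[[F]]+K[[F]]G+\cdots+K[[F]]G^{N-1}.$$ Set $R_i=K[[F]]+K[[F]]G+\cdots+K[[F]]G^i$ for $0\le i\le N-1$, $T_0=K$, and for $i=1,\dots,N-1$ $$T_i=\{G^i+\phi\ :\ \phi\in R_{i-1},\ v(G^i+\phi)\notin v(R_{i-1})\}.$$ Then $A_i=v(T_i)$ for every $i=0,\dots,N-1$.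
   Context: Rings and values. A plane algebroid curve over $K$ is a ring $\mathcal O=K[[X,Y]]/(H_1\cdots H_m)$ with $H_1,\dots,H_m$ irreducible and pairwise coprime; its branches are the rings $K[[X,Y]]/(H_i)$. The integral closure of each branch in its field of fractions is a power series ring $K[[t_i]]$. Hence for $R\cong\mathcal O_1\times\cdots\times\mathcal O_c$ with $d$ branches in total, the integral closure of $R$ in its total ring of fractions is $K[[t_1]]\times\cdots\times K[[t_d]]$, and each local factor has residue field $K$. For a non-zero-divisor $g\in R$, $v(g)=(v_1(g),\dots,v_d(g))\in\mathbb N^d$, where $v_i(g)$ is the order in $t_i$ of the $i$-th component. For a subset $Z\subseteq R$, $v(Z)$ is the set of values of the non-zero-divisors of $R$ lying in $Z$ (membership in $T_i$ presupposes that the value is defined); $S=v(R)$. $K[[F]]$ is the subring of formal power series in $F$. Orders. On $\mathbb N^d$, $\le$ is the componentwise order, $\alpha\wedge\beta$ is the componentwise minimum, and $\alpha\le\le\beta$ means that $\alpha=\beta$ or $\alpha_i<\beta_i$ for all $i$. For $U\subseteq\{1,\dots,d\}$, $\Delta^S_U(\alpha)=\{\beta\in S:\beta_i=\alpha_i \text{ for } i\in U,\ \beta_j>\alpha_j\text{ for } j\notin U\}$. Levels. An element $\alpha$ of $B\subseteq S$ is a complete infimum of $\beta^{(1)},\dots,\beta^{(r)}\in B$ ($r\ge2$) if $\beta^{(j)}\in\Delta^S_{F_j}(\alpha)$ for some nonempty $F_j\subsetneq\{1,\dots,d\}$, $\alpha=\beta^{(j)}\wedge\beta^{(k)}$ for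 all $j\ne k$, and $\bigcap_k F_k=\emptyset$. For $A=S\setminus E$, with $E=\omega+S$, define inductively for $i\ge1$: $B^{(i)}$ is the set of elements of $A\setminus\bigcup_{j<i}D^{(j)}$ that are maximal with respect to $\le\le$; $C^{(i)}$ is the set of $\alpha\in B^{(i)}$ that are complete infimum of some $\beta^{(1)},\dots,\beta^{(r)}\in B^{(i)}$ with $1<r\le d$; $D^{(i)}=B^{(i)}\setminus C^{(i)}$. Then $A$ is a finite disjoint union $\bigcup_{i=1}^N D^{(i)}$, where (known fact) $N=\omega_1+\cdots+\omega_d$, and the levels of $A$ are $A_i:=D^{(N-i)}$, $0\le i\le N-1$. *)

(* Defs.v *)
From HB Require Import structures.
From mathcomp Require Import all_boot all_order all_algebra.
From mathcomp Require Import boolp classical_sets cardinality.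

Set Implicit Arguments.
Unset Strict Implicit.
Unset Printing Implicit Defensive.

Import GRing.Theory.

Local Open Scope ring_scope.

Record fps (R : Type) := Fps { fps_coef :> nat -> R }.

Lemma fpsP (R : Type) (f g : fps R) : (forall n, f n = g n) -> f = g.
Proof. by case: f g => [f] [g] /= /funext ->. Qed.

HB.instance Definition _ (R : Type) := gen_eqMixin (fps R).
HB.instance Definition _ (R : Type) := gen_choiceMixin (fps R).

Section FpsRing.
Context {R : comNzRingType}.
Implicit Types f g h : fps R.

Definition fps_zero : fps R := Fps (fun=> 0).
Definition fps_opp f : fps R := Fps (fun n => - f n).
Definition fps_add f g : fps R := Fps (fun n => f n + g n).
Definition fps_const (c : R) : fps R := Fps (fun n => if n is 0 then c else 0).
Definition fps_mul f g : fps R :=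
  Fps (fun n => \sum_(i < n.+1) f i * g (n - i)%N).
Definition fps_scale (c : R) f : fps R := Fps (fun n => c * f n).

Fact fps_addA : associative fps_add.
Proof. by move=> f g h; apply: fpsP => n /=; rewrite addrA. Qed.
Fact fps_addC : commutative fps_add.
Proof. by move=> f g; apply: fpsP => n /=; rewrite addrC. Qed.
Fact fps_add0 : left_id fps_zero fps_add.
Proof. by move=> f; apply: fpsP => n /=; rewrite add0r. Qed.
Fact fps_addN : left_inverse fps_zero fps_opp fps_add.
Proof. by move=> f; apply: fpsP => n /=; rewrite addNr. Qed.

HB.instance Definition _ :=
  GRing.isZmodule.Build (fps R) fps_addA fps_addC fps_add0 fps_addN.

Fact fps_mul_rev f g n :
  fps_mul f g n = \sum_(i < n.+1) f (n - i)%N * g i.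
Proof.
rewrite /= (reindex_inj rev_ord_inj) /=.
by apply: eq_bigr => j _; rewrite (sub_ordK j).
Qed.

Fact fps_mulC : commutative fps_mul.
Proof.
move=> f g; apply: fpsP => n; rewrite fps_mul_rev /=.
by apply: eq_bigr => i _; rewrite mulrC.
Qed.

Fact fps_mulA : associative fps_mul.
Proof.
move=> p q r; apply: fpsP => i; rewrite [RHS]fps_mul_rev /=.
pose coef3 j k := p j * (q (i - j - k)%N * r k).
transitivity (\sum_(j < i.+1) \sum_(k < i.+1 | (k <= i - j)%N) coef3 j k).
  apply: eq_bigr => /= j _; have := fps_mul_rev q r (i - j) => /= ->.
  rewrite big_distrr /= (big_ord_narrow_leq (leq_subr _ _)).
  by apply: eq_bigr.
rewrite (exchange_big_dep predT) //=; apply: eq_bigr => k _.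
transitivity (\sum_(j < i.+1 | (j <= i - k)%N) coef3 j k).
  apply: eq_bigl => j; rewrite -ltnS -(ltnS j) -!subSn ?leq_ord //.
  by rewrite -subn_gt0 -(subn_gt0 j) -!subnDA addnC.
rewrite (big_ord_narrow_leq (leq_subr _ _)) big_distrl /=.
by apply: eq_bigr => j _; rewrite /coef3 -!subnDA addnC mulrA.
Qed.

Fact fps_mul1 : left_id (fps_const 1) fps_mul.
Proof.
move=> f; apply: fpsP => n /=; rewrite big_ord_recl /= subn0 mul1r big1 ?addr0//.
by move=> i _; rewrite mul0r.
Qed.

Fact fps_mulDl : left_distributive fps_mul +%R.
Proof.
move=> f g h; apply: fpsP => n /=; rewrite -big_split /=.
by apply: eq_bigr => i _; rewrite mulrDl.
Qed.

Fact fps_one_neq0 : fps_const 1 != 0 :> fps R.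
Proof.
apply/eqP => /(congr1 (fun f : fps R => f 0%N)) /= /eqP.
by rewrite oner_eq0.
Qed.

HB.instance Definition _ :=
  GRing.Zmodule_isComNzRing.Build (fps R)
    fps_mulA fps_mulC fps_mul1 fps_mulDl fps_one_neq0.

Fact fps_scaleA (a b : R) f : fps_scale a (fps_scale b f) = fps_scale (a * b) f.
Proof. by apply: fpsP => n /=; rewrite mulrA. Qed.
Fact fps_scale1 : left_id 1 fps_scale.
Proof. by move=> f; apply: fpsP => n /=; rewrite mul1r. Qed.
Fact fps_scaleDr : right_distributive fps_scale +%R.
Proof. by move=> c f g; apply: fpsP => n /=; rewrite mulrDr. Qed.
Fact fps_scaleDl f : {morph fps_scale^~ f : a b / a + b}.
Proof. by move=> a b; apply: fpsP => n /=; rewrite mulrDl. Qed.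

HB.instance Definition _ :=
  GRing.Zmodule_isLmodule.Build R (fps R)
    fps_scaleA fps_scale1 fps_scaleDr fps_scaleDl.

Fact fps_scaleAl (c : R) f g : c *: (f * g) = (c *: f) * g.
Proof.
apply: fpsP => n /=; rewrite big_distrr /=.
by apply: eq_bigr => i _; rewrite mulrA.
Qed.

HB.instance Definition _ :=
  GRing.Lmodule_isLalgebra.Build R (fps R) fps_scaleAl.
HB.instance Definition _ :=
  GRing.Lalgebra_isComAlgebra.Build R (fps R).

Definition fps_unit : pred (fps R) := fun f => `[< exists g, g * f = 1 >].
Definition fps_inv f : fps R :=
  if pselect (exists g, g * f = 1) is left h then projT1 (cid h) else f.

Fact fps_mulVf : {in fps_unit, left_inverse 1 fps_inv *%R}.
Proof.
move=> f /asboolP uf; rewrite /fps_inv.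
by case: pselect => // h; case: cid.
Qed.
Fact fps_unitP f g : g * f = 1 -> fps_unit f.
Proof. by move=> gf; apply/asboolP; exists g. Qed.
Fact fps_inv_out : {in [predC fps_unit], fps_inv =1 id}.
Proof.
move=> f /negP nuf; rewrite /fps_inv; case: pselect => // h.
by case: nuf; apply/asboolP.
Qed.

HB.instance Definition _ :=
  GRing.ComNzRing_hasMulInverse.Build (fps R) fps_mulVf fps_unitP fps_inv_out.

End FpsRing.

Fact fps_neq0 (R : comNzRingType) (f : fps R) : f != 0 -> exists n, f n != 0.
Proof.
move=> f0; apply: contrapT => nf; move/eqP: f0; apply; apply: fpsP => n /=.
by apply/eqP; apply: contrapT => /negP fn; apply: nf; exists n.
Qed.

(* Order in the variable; the order of 0, which would be +oo, is set to 0,  *)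
(* so only the order of a nonzero series is meaningful.                     *)
Definition fps_order (R : comNzRingType) (f : fps R) : nat :=
  if pselect (exists n, f n != 0) is left h then ex_minn h else 0%N.

Fact fps_integral (R : idomainType) : GRing.integral_domain_axiom (fps R).
Proof.
move=> f g fg0; apply: contrapT.
move/negP; rewrite negb_or => /andP[/fps_neq0 hf /fps_neq0 hg].
case: (ex_minnP hf) => m fm mmin; case: (ex_minnP hg) => n gn nmin.
have : (f * g) (m + n)%N = 0 by rewrite fg0.
have lt_m : (m < (m + n).+1)%N by rewrite ltnS leq_addr.
rewrite /= (bigD1 (Ordinal lt_m)) //= addKn big1 ?addr0.
  by move/eqP; rewrite mulf_eq0 (negPf fm) (negPf gn).
move=> i; rewrite -val_eqE /= neq_ltn => /orP[i_lt|i_gt].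
  have [->|/mmin] := eqVneq (f i) 0; first by rewrite mul0r.
  by rewrite leqNgt i_lt.
have [->|/nmin] := eqVneq (g (m + n - i)%N) 0; first by rewrite mulr0.
rewrite leq_subRL; last by rewrite -ltnS.
by rewrite leq_add2r leqNgt i_gt.
Qed.

HB.instance Definition _ (R : idomainType) :=
  GRing.ComUnitRing_isIntegral.Build (fps R) (@fps_integral R).

(* K[[X, Y]] = K[[X]][[Y]], as a K-algebra; the alias avoids a clash with   *)
(* the structure of K[[X]]-algebra of fps (fps K).                          *)
Definition fps2 (K : fieldType) := fps (fps K).

HB.instance Definition _ (K : fieldType) := GRing.IntegralDomain.on (fps2 K).

Section Fps2Algebra.
Context {K : fieldType}.
Implicit Types f g : fps2 K.

Definition fps2_scale (c : K) f : fps2 K := Fps (fun n => c *: f n).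

Fact fps2_scaleA (a b : K) f :
  fps2_scale a (fps2_scale b f) = fps2_scale (a * b) f.
Proof. by apply: fpsP => n /=; rewrite scalerA. Qed.
Fact fps2_scale1 : left_id 1 fps2_scale.
Proof. by move=> f; apply: fpsP => n /=; rewrite scale1r. Qed.
Fact fps2_scaleDr : right_distributive fps2_scale +%R.
Proof. by move=> c f g; apply: fpsP => n /=; rewrite scalerDr. Qed.
Fact fps2_scaleDl f : {morph fps2_scale^~ f : a b / a + b}.
Proof. by move=> a b; apply: fpsP => n /=; rewrite scalerDl. Qed.

HB.instance Definition _ :=
  GRing.Zmodule_isLmodule.Build K (fps2 K)
    fps2_scaleA fps2_scale1 fps2_scaleDr fps2_scaleDl.

Fact fps2_scaleAl (c : K) f g : c *: (f * g) = (c *: f) * g.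
Proof.
apply: fpsP => n /=; rewrite scaler_sumr.
by apply: eq_bigr => i _; rewrite scalerAl.
Qed.

HB.instance Definition _ :=
  GRing.Lmodule_isLalgebra.Build K (fps2 K) fps2_scaleAl.
HB.instance Definition _ :=
  GRing.Lalgebra_isComAlgebra.Build K (fps2 K).

End Fps2Algebra.

Definition irreducible_elt (A : idomainType) (h : A) : Prop :=
  [/\ h != 0, h \isn't a GRing.unit &
      forall a b : A, h = a * b -> a \is a GRing.unit \/ b \is a GRing.unit].

Definition coprime_elts (A : idomainType) (h k : A) : Prop :=
  forall e : A, (exists a, h = e * a) -> (exists b, k = e * b) ->
    e \is a GRing.unit.

(* Up to isomorphism, pi is the projection A -> A/(h). *)
Definition is_quotient_by (A B : pzRingType) (pi : A -> B) (h : A) : Prop :=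
  (forall y, exists x, pi x = y) /\
  (forall x, pi x = 0 <-> exists a, x = a * h).

(* nu identifies K[[t]] with the integral closure of the domain B in its    *)
(* field of fractions, the latter being seen inside K((t)) through nu: an   *)
(* element q of K((t)) lies in K[[t]] if and only if it is a quotient of    *)
(* elements of nu(B) that is integral over nu(B).                           *)
Definition is_normalization (K : fieldType) (B : comAlgType K)
    (nu : {lrmorphism B -> fps K}) : Prop :=
  injective nu /\
  forall q : {fraction fps K},
    (exists z : fps K, q = tofrac z) <->
    (exists a b : B, b != 0 /\ q = tofrac (nu a) / tofrac (nu b)) /\
    integralOver (@tofrac (fps K) \o nu) q.

(* R = O_1 x ... x O_c with O_j a plane algebroid curve over K, with d      *)
(* branches in total, indexed by 'I_d: the i-th branch belongs to the local *)
(* factor of index [factor_of i].  When K is not algebraically closed, the  *)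
(* existence of the parametrizations [param i] is part of the requirement   *)
(* (it excludes, for instance, X^2 + Y^2 over the real numbers).            *)
Record curve_product (K : fieldType) (R : comAlgType K) (c d : nat) := {
  factor_of : 'I_d -> 'I_c;
  factor_ofP : forall j, exists i, factor_of i = j;

  branch_eqn : 'I_d -> fps2 K;
  branch_eqn_irreducible : forall i, irreducible_elt (branch_eqn i);
  branch_eqn_coprime : forall i k, i != k -> factor_of i = factor_of k ->
    coprime_elts (branch_eqn i) (branch_eqn k);

  factor : 'I_c -> comAlgType K;
  factor_pi : forall j, {lrmorphism fps2 K -> factor j};
  factor_piP : forall j,
    is_quotient_by (factor_pi j) (\prod_(i | factor_of i == j) branch_eqn i);

  proj : forall j, {lrmorphism R -> factor j};
  projP : forall y : (forall j, factor j), exists! x : R,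
    forall j, proj j x = y j;

  branch : 'I_d -> comAlgType K;
  branch_pi : forall i, {lrmorphism fps2 K -> branch i};
  branch_piP : forall i, is_quotient_by (branch_pi i) (branch_eqn i);

  to_branch : forall i, {lrmorphism factor (factor_of i) -> branch i};
  to_branchP : forall i (h : fps2 K),
    to_branch i (factor_pi (factor_of i) h) = branch_pi i h;

  param : forall i, {lrmorphism branch i -> fps K};
  paramP : forall i, is_normalization (param i)
}.

(* The components of the image of g in K[[t_1]] x ... x K[[t_d]]. *)
Definition component (K : fieldType) (R : comAlgType K) (c d : nat)
    (C : curve_product R c d) (g : R) (i : 'I_d) : fps K :=
  param C i (to_branch C i (proj C (factor_of C i) g)).

(* Meaningful for non-zero-divisors only. *)
Definition value (K : fieldType) (R : comAlgType K) (c d : nat)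
    (C : curve_product R c d) (g : R) : {ffun 'I_d -> nat} :=
  [ffun i => fps_order (component C g i)].

(* v(Z); GRing.lreg g states that g is not a zero divisor. *)
Definition value_set (K : fieldType) (R : comAlgType K) (c d : nat)
    (C : curve_product R c d) (Z : set R) : set {ffun 'I_d -> nat} :=
  [set a | exists g : R, [/\ Z g, GRing.lreg g & value C g = a]]%classic.

(* The order "<= <=" on N^d. *)
Definition lele (d : nat) (a b : {ffun 'I_d -> nat}) : Prop :=
  a = b \/ forall i, (a i < b i)%N.

Definition inf_vec (d : nat) (a b : {ffun 'I_d -> nat}) : {ffun 'I_d -> nat} :=
  [ffun i => minn (a i) (b i)].

Definition Delta (d : nat) (S : set {ffun 'I_d -> nat}) (U : {set 'I_d})
    (a : {ffun 'I_d -> nat}) : set {ffun 'I_d -> nat} :=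
  [set b | [/\ S b, forall i, i \in U -> b i = a i &
               forall j, j \notin U -> (a j < b j)%N]]%classic.

Definition complete_infimum (d r : nat) (S B : set {ffun 'I_d -> nat})
    (a : {ffun 'I_d -> nat}) (b : 'I_r -> {ffun 'I_d -> nat}) : Prop :=
  [/\ (2 <= r)%N, B a, forall j, B (b j) &
      exists F : 'I_r -> {set 'I_d},
        [/\ forall j, [/\ F j != finset.set0, F j \proper [set: 'I_d]%SET &
                          Delta S (F j) a (b j)],
            forall j k, j != k -> a = inf_vec (b j) (b k) &
            (\bigcap_j F j)%SET = finset.set0]].

Definition apery (d : nat) (S : set {ffun 'I_d -> nat})
    (omega : {ffun 'I_d -> nat}) : set {ffun 'I_d -> nat} :=
  [set a | S a /\ ~ exists2 b, S b & a = [ffun i => (omega i + b i)%N]]%classic.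

(* One step of the construction of the levels: X is the set of the elements *)
(* that have not been removed yet.                                          *)
Definition step_B (d : nat) (X : set {ffun 'I_d -> nat}) :
    set {ffun 'I_d -> nat} :=
  [set a | X a /\ forall b, X b -> lele a b -> b = a]%classic.

Definition step_C (d : nat) (S X : set {ffun 'I_d -> nat}) :
    set {ffun 'I_d -> nat} :=
  [set a | step_B X a /\
     exists (r : nat) (b : 'I_r -> {ffun 'I_d -> nat}),
       (1 < r <= d)%N /\ complete_infimum S (step_B X) a b]%classic.

Definition step_D (d : nat) (S X : set {ffun 'I_d -> nat}) :
    set {ffun 'I_d -> nat} :=
  (step_B X `\` step_C S X)%classic.

(* The union of D^(1), ..., D^(i). *)
Fixpoint removed (d : nat) (S A : set {ffun 'I_d -> nat}) (i : nat) :
    set {ffun 'I_d -> nat} :=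
  if i is j.+1 then
    (removed S A j `|` step_D S (A `\` removed S A j))%classic
  else set0.

(* D^(i), for i >= 1. *)
Definition D_set (d : nat) (S A : set {ffun 'I_d -> nat}) (i : nat) :
    set {ffun 'I_d -> nat} :=
  step_D S (A `\` removed S A i.-1)%classic.

(* The level A_i = D^(N - i), for 0 <= i < N = omega_1 + ... + omega_d. *)
Definition level (d : nat) (S : set {ffun 'I_d -> nat})
    (omega : {ffun 'I_d -> nat}) (i : nat) : set {ffun 'I_d -> nat} :=
  D_set S (apery S omega) (\sum_k omega k - i)%N.

(* K[[F]], for F in the Jacobson radical of R: the elements that are the    *)
(* sum of some series \sum_k a_k F^k, which converges in the F-adic         *)
(* topology (for v(F) > 0 this is the topology of R, which is complete).    *)
Definition power_series_in (K : fieldType) (R : comAlgType K) (F : R) : set R :=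
  [set x | exists a : nat -> K, forall n, exists r : R,
     x = \sum_(k < n) a k *: F ^+ k + F ^+ n * r]%classic.

(* K[[F]] + K[[F]] G + ... + K[[F]] G^i. *)
Definition span_upto (K : fieldType) (R : comAlgType K) (F G : R) (i : nat) :
    set R :=
  [set x | exists y : 'I_i.+1 -> R,
     (forall k, power_series_in F (y k)) /\
     x = \sum_(k < i.+1) y k * G ^+ k]%classic.

Definition T_set (K : fieldType) (R : comAlgType K) (c d : nat)
    (C : curve_product R c d) (F G : R) (i : nat) : set R :=
  (if i is j.+1 then
     [set g | exists2 phi, span_upto F G j phi &
        [/\ g = G ^+ i + phi, GRing.lreg g &
            ~ value_set C (span_upto F G j) (value C g)]]
   else [set g | exists a : K, g = a%:A])%classic.

(* Main.v *)
Require Import Defs.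
From HB Require Import structures.
From mathcomp Require Import all_boot all_order all_algebra.
From mathcomp Require Import boolp classical_sets cardinality.
From mathcomp Require Import zify ring.

Set Implicit Arguments.
Unset Strict Implicit.
Unset Printing Implicit Defensive.

Import GRing.Theory.

Local Open Scope ring_scope.

(* Write R(a) for the elements of R of value at least a and M(a) = F R + R(a), an ideal.
   Modulo M(a) the ring R is generated by G, so M(a) is given by a monic polynomial in G,
   whose degree is ell(a) = dim R/M(a); ell grows by at most 1 when one coordinate of a is
   raised by 1.  The proof is that, for a in the Apery set A, the level of a is ell(a).

   If a, b are in A and b is greater than a in every coordinate then ell(b) > ell(a),
   because M(a) = M(b) would let an element of F R have value a.  The same argument shows
   that a is no infimum of elements b_j of A with ell(b_j) = ell(a) such that every
   coordinate is raised by some b_j.  Conversely, let ell(a) < n.  If ell(a + (1,...,1)) <= n,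
   some element of A of the same ell lies above a + (1,...,1); otherwise linear algebra on
   the leading coefficients of R(a) exhibits a as a complete infimum of elements b_j of A
   with ell(b_j) <= ell(a) + 1.

   For the sets T_i: when ell(b) <= i, polynomials in F and G of degree less than i in G
   approximate all of R modulo R(b).  Hence an element of A with ell(a) = i is the value of
   some G^i + phi, while a value a of G^i + phi with ell(a) < i, or outside A, would be
   attained in R_(i-1).  That ell reaches N (so that 1, G, ..., G^(N-1) are independent
   modulo F) is a dimension count modulo R(n omega) for n large, given that every branch
   contributes all sufficiently large orders. *)

(** * Leading terms of products and linear dependence *)

Lemma fps_mul_lead {K : fieldType} {f g : fps K} {a b : nat} :
  (forall m, (m < a)%N -> f m = 0) -> (forall m, (m < b)%N -> g m = 0) ->
  (forall m, (m < a + b)%N -> (f * g) m = 0) /\ (f * g) (a + b)%N = f a * g b.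
Proof.
move=> f0 g0; split=> [m mab|].
  rewrite /= big1 // => i _; have [/f0->|ai] := ltnP i a; first by rewrite mul0r.
  by rewrite (g0 (m - i)%N) ?mulr0 //; have := ltn_ord i; lia.
have la : (a < (a + b).+1)%N by lia.
rewrite /= (bigD1 (Ordinal la)) //= addKn big1 ?addr0 // => i.
rewrite -val_eqE /= => ia; have [/f0->|ai] := ltnP i a; first by rewrite mul0r.
by rewrite (g0 (a + b - i)%N) ?mulr0 //; have := ltn_ord i; lia.
Qed.

Lemma fps_sumE {K : fieldType} (I : finType) (f : I -> fps K) m :
  (\sum_i f i) m = \sum_i f i m.
Proof. by elim/big_ind2: _ => // x1 x2 y1 y2 <- <-. Qed.

Lemma row_dependence {K : fieldType} {T U : finType} (A : T -> U -> K) :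
  (#|U| < #|T|)%N ->
  exists u : T -> K, (exists t, u t != 0) /\ forall v, \sum_t u t * A t v = 0.
Proof.
move=> ltUT; pose B := \matrix_(i < #|T|, j < #|U|) A (enum_val i) (enum_val j).
have : kermx B != 0.
  by rewrite -mxrank_eq0 mxrank_ker -lt0n subn_gt0 (leq_ltn_trans (rank_leq_col B)).
case/matrix0Pn=> i [j kij].
exists (fun t => kermx B i (enum_rank t)); split.
  by exists (enum_val j); rewrite enum_valK.
move=> v; have /matrixP/(_ i (enum_rank v)) := mulmx_ker B.
rewrite !mxE (reindex (@enum_rank T)) /= => [e|].
  by apply: etrans e; apply: eq_bigr => t _; rewrite !mxE !enum_rankK.
exact/onW_bij/enum_rank_bij.
Qed.

(** * The filtration of [R] by values *)

Section Filtration.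

Context (K : fieldType) (R : comAlgType K) (d : nat).
Variable comp : 'I_d -> {lrmorphism R -> fps K}.

Notation vec := {ffun 'I_d -> nat}.
Implicit Types (a b : vec) (x y z : R) (k l : 'I_d) (P : {set 'I_d}).

(** Vanishing coefficients are used rather than [fps_order], so that zero components count as having
    infinite order. *)
Definition filt a x : Prop := forall k m, (m < a k)%N -> comp k x m = 0.

Definition lead a k x : K := comp k x (a k).

Definition hasval x a : Prop := filt a x /\ forall k, lead a k x != 0.

Definition bump_vec a P : vec := [ffun k => (a k + (k \in P))%N].

Lemma compD k x y m : comp k (x + y) m = comp k x m + comp k y m.
Proof. by rewrite rmorphD. Qed.

Lemma compN k x m : comp k (- x) m = - comp k x m.
Proof. by rewrite rmorphN. Qed.

Lemma compZ k (s : K) x m : comp k (s *: x) m = s * comp k x m.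
Proof. by rewrite linearZ. Qed.

Lemma leadD a k x y : lead a k (x + y) = lead a k x + lead a k y.
Proof. exact: compD. Qed.

Lemma leadN a k x : lead a k (- x) = - lead a k x.
Proof. exact: compN. Qed.

Lemma leadZ a k (s : K) x : lead a k (s *: x) = s * lead a k x.
Proof. exact: compZ. Qed.

Lemma filt0 a : filt a 0.
Proof. by move=> k m _; rewrite rmorph0. Qed.

Lemma filtD a x y : filt a x -> filt a y -> filt a (x + y).
Proof. by move=> hx hy k m mk; rewrite compD hx // hy // addr0. Qed.

Lemma filtZ a (s : K) x : filt a x -> filt a (s *: x).
Proof. by move=> hx k m mk; rewrite compZ hx // mulr0. Qed.

Lemma filtN a x : filt a x -> filt a (- x).
Proof. by move=> hx k m mk; rewrite compN hx // oppr0. Qed.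

Lemma filtB a x y : filt a x -> filt a y -> filt a (x - y).
Proof. by move=> hx hy; apply/filtD/filtN. Qed.

Lemma filt_le {a b x} : (forall k, (a k <= b k)%N) -> filt b x -> filt a x.
Proof. by move=> ab hx k m mk; apply: hx; apply: leq_trans (ab k). Qed.

Lemma filt_const0 x : filt [ffun => 0%N] x.
Proof. by move=> k m; rewrite ffunE. Qed.

Lemma filtM a b x y : filt a x -> filt b y -> filt [ffun k => (a k + b k)%N] (x * y).
Proof.
move=> hx hy k m; rewrite ffunE rmorphM.
by have [h _] := fps_mul_lead (hx k) (hy k); apply: h.
Qed.

Lemma leadM a b k x y : filt a x -> filt b y ->
  lead [ffun k => (a k + b k)%N] k (x * y) = lead a k x * lead b k y.
Proof.
move=> hx hy; rewrite /lead ffunE rmorphM.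
by have [_ h] := fps_mul_lead (hx k) (hy k).
Qed.

Lemma filtMl a x y : filt a y -> filt a (x * y).
Proof.
move=> hy; apply: filt_le (filtM (filt_const0 x) hy) => k.
by rewrite !ffunE.
Qed.

Lemma hasvalM x y a b : hasval x a -> hasval y b ->
  hasval (x * y) [ffun k => (a k + b k)%N].
Proof.
move=> [hx lx] [hy ly]; split=> [|k]; first exact: filtM.
by rewrite leadM // mulf_neq0.
Qed.

Lemma hasval_inj x a b : hasval x a -> hasval x b -> a = b.
Proof.
move=> [hx lx] [hy ly]; apply/ffunP => k; apply/eqP.
have := lx k; have := ly k; rewrite /lead.
by case: ltngtP => // [/hy->|/hx->]; rewrite eqxx.
Qed.

Lemma hasval1 : hasval 1 [ffun => 0%N].
Proof.
split=> [|k]; first exact: filt_const0.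
by rewrite /lead ffunE rmorph1 oner_eq0.
Qed.

Lemma hasval_ex x : (forall k, comp k x != 0) -> exists a, hasval x a.
Proof.
move=> x0; pose ex k := fps_neq0 (x0 k).
exists [ffun k => ex_minn (ex k)]; split=> [k m|k]; rewrite /lead ffunE.
  case: ex_minnP => n _ hn mn; apply/eqP/contraT => /hn.
  by rewrite leqNgt mn.
by case: ex_minnP.
Qed.

Lemma hasval_neq0 x a k : hasval x a -> comp k x != 0.
Proof. by move=> [_ /(_ k)]; apply: contra => /eqP; rewrite /lead => ->. Qed.

Lemma bump_vec_le a P k : (a k <= bump_vec a P k)%N.
Proof. by rewrite ffunE leq_addr. Qed.

Lemma filt_bump a P x :
  filt a x -> (forall k, k \in P -> lead a k x = 0) -> filt (bump_vec a P) x.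
Proof.
move=> hx h k m; rewrite ffunE; case: (boolP (k \in P)) => kP; last first.
  by rewrite addn0; apply: hx.
rewrite addn1 ltnS leq_eqVlt => /orP[/eqP->|]; [exact: h | exact: hx].
Qed.

Lemma filt_unbump {a P x} : filt (bump_vec a P) x -> filt a x.
Proof. by apply: filt_le => k; apply: bump_vec_le. Qed.

Lemma lead_bump a P x k : filt (bump_vec a P) x -> k \in P -> lead a k x = 0.
Proof. by move=> h kP; apply: h; rewrite ffunE kP addn1. Qed.

Lemma filt_elim a k x z : filt a x -> filt a z -> lead a k z != 0 ->
  filt (bump_vec a [set k]%SET) (x - (lead a k x / lead a k z) *: z).
Proof.
move=> hx hz lz; apply: filt_bump => [|l]; first exact/filtB/filtZ.
by rewrite inE => /eqP->; rewrite leadD leadN leadZ divfK // subrr.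
Qed.

Lemma hasvalD a x y : hasval x a -> filt (bump_vec a [set: 'I_d]%SET) y ->
  hasval (x + y) a.
Proof.
move=> [hx lx] hy; split; first exact: filtD (filt_unbump hy).
by move=> k; rewrite leadD (lead_bump hy) ?inE // addr0.
Qed.

Lemma hasval_lt a x : hasval x a -> forall b, filt b x -> forall k, (b k <= a k)%N.
Proof.
move=> [_ lx] b hb k; rewrite leqNgt; apply/negP => /hb; apply/eqP; exact: lx.
Qed.

Hypothesis infK : forall s : seq K, exists c, c \notin s.

(* Over an infinite field a linear space is not a finite union of proper subspaces. *)
Lemma generic_lead (Q : R -> Prop) a (P : pred 'I_d) :
  (forall x y, Q x -> Q y -> Q (x + y)) -> (forall (s : K) x, Q x -> Q (s *: x)) ->
  (exists x, Q x) ->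
  (forall k, P k -> exists2 x, Q x & lead a k x != 0) ->
  exists2 x, Q x & forall k, P k -> lead a k x != 0.
Proof.
move=> QD QZ [q0 Qq0] hP.
suff [x Qx hx] : exists2 x, Q x & forall k, k \in enum P -> lead a k x != 0.
  by exists x => // k Pk; apply: hx; rewrite mem_enum.
have : {subset enum P <= P} by move=> k; rewrite mem_enum.
elim: (enum P) => [|k s IH] sP; first by exists q0.
have [|x Qx hx] := IH; first by move=> l ls; apply: sP; rewrite inE ls orbT.
have [y Qy hy] : exists2 y, Q y & lead a k y != 0.
  by apply/hP/(sP k); rewrite inE eqxx.
(* Each coordinate with [lead a l x] nonzero forbids one scalar in [y + c *: x]. At [k], if
   [lead a k x] vanishes, [y] alone decides. *)
have [c cN] := infK ([seq - lead a l y / lead a l x | l <- s]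
                     ++ [:: - lead a k y / lead a k x]).
move: cN; rewrite mem_cat inE negb_or => /andP[cs ck].
have key l : lead a l x != 0 -> c != - lead a l y / lead a l x ->
    lead a l (y + c *: x) != 0.
  move=> lx; apply: contra; rewrite leadD leadZ addrC addr_eq0 => /eqP e.
  by rewrite -e mulfK.
exists (y + c *: x) => [|l]; first exact/QD/QZ.
rewrite inE => /predU1P[->|ls]; last first.
  apply: key; first exact: hx.
  by apply: contra cs => /eqP->; apply: map_f.
have [x0|x0] := eqVneq (lead a k x) 0; last exact: key.
by rewrite leadD leadZ x0 mulr0 addr0.
Qed.

End Filtration.

(** * The ideals F R + R(a) and their codimension [ell] *)

Section Levels.

Context (K : fieldType) (R : comAlgType K) (d : nat).
Variable comp : 'I_d -> {lrmorphism R -> fps K}.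
Hypothesis infK : forall s : seq K, exists c, c \notin s.

Notation vec := {ffun 'I_d -> nat}.
Local Notation filt := (filt comp).
Local Notation lead := (lead comp).
Local Notation hasval := (hasval comp).
Implicit Types (a b : vec) (x y z : R) (k l : 'I_d) (P : {set 'I_d}).
Implicit Types (p q : {poly K}).

Variables (F G : R) (omega : vec).
Variable N : nat.
Hypothesis N_sum : N = (\sum_k omega k)%N.
Hypothesis F_val : hasval F omega.
Hypothesis omega_gt0 : forall k, (0 < omega k)%N.
Local Notation pev := (horner_alg G).
Hypothesis gen : forall x, exists (q : {poly K}) r, (size q <= N)%N /\ x = pev q + F * r.
Hypothesis conductor : exists n0 : nat, forall k n, (n0 <= n)%N ->
  exists x, [/\ forall l, l != k -> comp l x = 0,
                forall m, (m < n)%N -> comp k x m = 0 & comp k x n != 0].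

Definition F_filt a x : Prop := exists r y, filt a y /\ x = F * r + y.

Lemma F_filt_filt a x : filt a x -> F_filt a x.
Proof. by exists 0, x; rewrite mulr0 add0r. Qed.

Lemma F_filtF a r : F_filt a (F * r).
Proof. by exists r, 0; rewrite addr0; split=> //; exact: filt0. Qed.

Lemma F_filtD a x y : F_filt a x -> F_filt a y -> F_filt a (x + y).
Proof.
move=> [r [u [hu ->]]] [s [v [hv ->]]]; exists (r + s), (u + v).
by split; [exact: filtD | ring].
Qed.

Lemma F_filtMl a x y : F_filt a y -> F_filt a (x * y).
Proof.
move=> [r [u [hu ->]]]; exists (x * r), (x * u).
by split; [exact: filtMl | ring].
Qed.

Lemma F_filtB a x y : F_filt a x -> F_filt a y -> F_filt a (x - y).
Proof. by move=> hx hy; apply: F_filtD => //; rewrite -mulN1r; apply: F_filtMl. Qed.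

Lemma F_filt_sub a b : (forall x, filt b x -> filt a x) ->
  forall x, F_filt b x -> F_filt a x.
Proof. by move=> h x [r [y [/h hy ->]]]; exists r, y. Qed.

(** Reducing [G ^+ N] modulo [F] yields a monic relation in F R, which serves every [a]. *)
Lemma char_poly_exists a : exists2 p : {poly K}, size p = N.+1 & F_filt a (pev p).
Proof.
have [q [r [sq e]]] := gen (G ^+ N); exists ('X^N - q).
  by rewrite size_polyDl ?size_polyXn // size_polyN ltnS.
by rewrite rmorphB rmorphXn /= horner_algX e addrC addKr; apply: F_filtF.
Qed.

Lemma ell_ex a :
  exists n, `[< exists p : {poly K}, size p = n.+1 /\ F_filt a (pev p) >].
Proof. by have [p sp hp] := char_poly_exists a; exists N; apply/asboolP; exists p. Qed.

(* R / (F R + R(a)) is a quotient of K[z] via z |-> G; [ell a] is its dimension. *)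
Definition ell a : nat := ex_minn (ell_ex a).

Lemma ell_gen a : exists2 p : {poly K}, size p = (ell a).+1 & F_filt a (pev p).
Proof. by rewrite /ell; case: ex_minnP => n /asboolP[p [sp hp]] _; exists p. Qed.

Lemma ell_min a p : F_filt a (pev p) -> p != 0 -> (ell a < size p)%N.
Proof.
move=> hp p0; rewrite /ell; case: ex_minnP => n _ /(_ (size p).-1).
have sp : (size p).-1.+1 = size p by rewrite prednK // lt0n size_poly_eq0.
move=> h; rewrite -[X in (_ < X)%N]sp ltnS; apply: h; apply/asboolP.
by exists p; rewrite sp.
Qed.

Lemma ell_red a x : exists2 q : {poly K}, (size q <= ell a)%N & F_filt a (x - pev q).
Proof.
have [p sp hp] := ell_gen a; have [q [r [_ ->]]] := gen x.
have p0 : p != 0 by rewrite -size_poly_gt0 sp.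
exists (q %% p); first by rewrite -ltnS -sp ltn_modp.
rewrite {1}(divp_eq q p) rmorphD rmorphM /=.
have -> : pev (q %/ p) * pev p + pev (q %% p) + F * r - pev (q %% p)
  = pev (q %/ p) * pev p + F * r by ring.
exact/F_filtD/F_filtF/F_filtMl.
Qed.

Lemma ell_sub a b : (forall x, F_filt b x -> F_filt a x) -> (ell a <= ell b)%N.
Proof.
have [p sp hp] := ell_gen b; move/(_ _ hp) => /ell_min.
by rewrite -size_poly_gt0 sp ltnS; apply.
Qed.

(** Nested ideals of equal codimension coincide: the remainder of [x] modulo the smaller one lies in
    the larger one, and its degree is too small for it to be nonzero. *)
Lemma F_filt_ell a b : (forall x, F_filt b x -> F_filt a x) ->
  (ell b <= ell a)%N -> forall x, F_filt a x -> F_filt b x.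
Proof.
move=> sub ba x hx; have [q sq hq] := ell_red b x.
suff q0 : q = 0 by rewrite q0 rmorph0 subr0 in hq.
apply/eqP/contraT => q0; have : F_filt a (pev q).
  by rewrite -[pev q](subKr x); apply/F_filtB/sub.
by move/ell_min => /(_ q0); rewrite ltnNge (leq_trans sq ba).
Qed.

Lemma ell_filt a b : (forall x, filt b x -> filt a x) -> (ell a <= ell b)%N.
Proof. by move=> h; apply/ell_sub/F_filt_sub. Qed.

Lemma ell_le a b : (forall k, (a k <= b k)%N) -> (ell a <= ell b)%N.
Proof. by move=> ab; apply: ell_filt => x; apply: filt_le. Qed.

(* If c is the constant term of G at k, then G - c maps R(a) into R(a + e_k). *)
Lemma ell_bump1 a k : (ell (bump_vec a [set k]%SET) <= (ell a).+1)%N.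
Proof.
have [p sp [r [y [hy e]]]] := ell_gen a.
have p0 : p != 0 by rewrite -size_poly_gt0 sp.
pose c := comp k G 0%N.
have sq : size (p * ('X - c%:P)) = (ell a).+2.
  by rewrite size_Mmonic ?monicXsubC // size_XsubC sp addn2.
suff /ell_min : F_filt (bump_vec a [set k]%SET) (pev (p * ('X - c%:P))).
  by rewrite -size_poly_gt0 sq ltnS; apply.
exists (r * (G - c%:A)), ((G - c%:A) * y); split; last first.
  by rewrite rmorphM rmorphB /= e horner_algX horner_algC; ring.
apply: filt_bump => [|l]; first exact: filtMl.
rewrite inE => /eqP->; have := leadM k (@filt_const0 _ _ _ comp (G - c%:A)) hy.
have -> : [ffun k => ([ffun=> 0%N] k + a k)%N] = a.
  by apply/ffunP => j; rewrite !ffunE.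
move=> ->; rewrite leadD leadN leadZ /lead ffunE rmorph1 mulr1 subrr mul0r.
by [].
Qed.

(** Multiples of [F] replace omega + S here; [apery_in] compares the two. *)
Definition in_apery a : Prop := (exists x, hasval x a) /\ ~ exists r, hasval (F * r) a.

(** If the codimensions agreed, an element of value [a] would be F r + y with y of higher order in
    every coordinate, and F r would have value [a]. *)
Lemma ell_lt_bump a : in_apery a -> (ell a < ell (bump_vec a [set: 'I_d]%SET))%N.
Proof.
move=> [[x hx] nE]; rewrite ltnNge; apply/negP => le_ell.
have [|r [y [hy e]]] := F_filt_ell _ le_ell (F_filt_filt (proj1 hx)).
  by apply: F_filt_sub => z; apply: filt_unbump.
by apply: nE; exists r; rewrite -[F * r](addrK y) -e; apply/hasvalD/filtN.
Qed.

Lemma F_filt_step a k r x : filt a (F * r) -> lead a k (F * r) != 0 ->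
  F_filt a x -> F_filt (bump_vec a [set k]%SET) x.
Proof.
move=> hr lr [s [y [hy ->]]]; apply: F_filtD; first exact: F_filtF.
set c := lead a k y / lead a k (F * r).
rewrite -[y](subrK (c *: (F * r))); apply: F_filtD.
  exact/F_filt_filt/filt_elim.
by rewrite scalerAr; apply: F_filtF.
Qed.

Lemma hasval_expF n : hasval (F ^+ n) [ffun k => (n * omega k)%N].
Proof.
elim: n => [|n IH]; last first.
  rewrite exprS; have -> : [ffun k => (n.+1 * omega k)%N] =
      [ffun k => (omega k + [ffun l => (n * omega l)%N] k)%N] :> vec.
    by apply/ffunP => k; rewrite !ffunE mulSn.
  exact: hasvalM.
rewrite expr0; have -> : [ffun k => (0 * omega k)%N] = [ffun => 0%N] :> vec.
  by apply/ffunP => k; rewrite !ffunE.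
exact: hasval1.
Qed.

Lemma filt_expF a : exists n, forall r, filt a (F ^+ n * r).
Proof.
exists (\sum_k a k)%N => r; rewrite mulrC; apply: filtMl.
apply: filt_le (proj1 (hasval_expF _)) => k; rewrite ffunE.
by rewrite (leq_trans _ (leq_pmulr _ (omega_gt0 k))) // (bigD1 k) //= leq_addr.
Qed.

(** Take for [b k] the least order occurring at [k] in R(a), finite thanks to a power of [F]; over
    an infinite field one element attains all these minima. *)
Lemma generic_val a : exists b, [/\ forall k, (a k <= b k)%N,
  forall x, filt a x -> filt b x & exists x, hasval x b].
Proof.
have ex k : exists n, `[< exists2 x, filt a x & comp k x n != 0 >].
  have [n hn] := filt_expF a; exists (n * omega k)%N; apply/asboolP.
  exists (F ^+ n); first by rewrite -[F ^+ n]mulr1.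
  by have [_ /(_ k)] := hasval_expF n; rewrite /lead ffunE.
pose b : vec := [ffun k => ex_minn (ex k)].
have ab x : filt a x -> filt b x.
  move=> hx k m; rewrite ffunE; case: ex_minnP => n _ hn mn.
  apply/eqP/contraT => xm; suff /hn : `[< exists2 x, filt a x & comp k x m != 0 >].
    by rewrite leqNgt mn.
  by apply/asboolP; exists x.
have bb k : (a k <= b k)%N.
  rewrite ffunE; case: ex_minnP => n /asboolP[x hx xn] _.
  by rewrite leqNgt; apply/negP => /hx; apply/eqP.
exists b; split=> //; have [||||x hx lx] := @generic_lead _ _ _ comp infK (filt a) b predT.
- by move=> x y; apply: filtD.
- by move=> s x; apply: filtZ.
- by exists 0; apply: filt0.
- move=> k _; suff [x hx xk] : exists2 x, filt a x & comp k x (b k) != 0 by exists x.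
  by rewrite ffunE; case: ex_minnP => n /asboolP.
by exists x; split=> [|k]; [exact: ab | exact: lx].
Qed.

(** Iterates [ell_red] on the cofactor of [F]; the errors stay in the ideal R(b). *)
Lemma F_expansion b n x : exists (q : nat -> {poly K}) r y,
  [/\ forall s, (size (q s) <= ell b)%N, filt b y &
      x = \sum_(s < n) F ^+ s * pev (q s) + F ^+ n * r + y].
Proof.
elim: n x => [|n IH] x.
  exists (fun=> 0), x, 0; split=> [s||]; rewrite ?size_poly0 //; first exact: filt0.
  by rewrite big_ord0 expr0; ring.
have [q0 s0 [r0 [y0 [hy0 e0]]]] := ell_red b x.
have [q [r [y [sq hy e]]]] := IH r0.
exists (fun s => if s is s'.+1 then q s' else q0), r, (F * y + y0); split.
- by case.
- exact/filtD/hy0/filtMl.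
rewrite big_ord_recl expr0.
rewrite (eq_bigr (fun s : 'I_n => F * (F ^+ s * pev (q s)))); last first.
  by move=> s _; rewrite exprS mulrA.
rewrite -big_distrr /= exprS -[x in LHS](subrK (pev q0)) e0 e.
by ring.
Qed.

Lemma pev_expand m p : (size p <= m)%N -> pev p = \sum_(j < m) p`_j *: G ^+ j.
Proof.
move=> sp; have {1}-> : p = \poly_(j < m) p`_j.
  apply/polyP => j; rewrite coef_poly; case: ltnP => // mj.
  by rewrite nth_default // (leq_trans sp).
rewrite poly_def rmorph_sum; apply: eq_bigr => j _.
by rewrite /= -mul_polyC rmorphM rmorphXn /= horner_algC horner_algX mulr_algl.
Qed.

(** If ell(n omega) < N, the products F^s G^j with s < n and j < ell(n omega) span R modulo R(n
    omega), but they are fewer than the independent elements supplied by [conductor]. *)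
Lemma ell_large : exists a, (N <= ell a)%N.
Proof.
have [n0 zP] := conductor.
(* With this [n], n N - d n0 exceeds n (N - 1). *)
pose n := (d * n0).+1; pose w : vec := [ffun k => (n * omega k)%N].
exists w; rewrite leqNgt; apply/negP => lt_ell.
(* A pair (k, i) stands for an element supported on branch k, of order n0 + i < n omega_k. *)
pose T : finType := {k : 'I_d & 'I_(n * omega k - n0)}.
pose U : finType := ('I_n * 'I_(ell w))%type.
have /choice[z zT] : forall t : T, exists x,
    [/\ forall l, l != tag t -> comp l x = 0,
        forall m, (m < n0 + tagged t)%N -> comp (tag t) x m = 0 &
        comp (tag t) x (n0 + tagged t)%N != 0].
  by move=> t; apply: zP; rewrite leq_addr.
have /choice[c cT] : forall t : T, exists c : U -> K,
    filt w (z t - \sum_u c u *: (F ^+ u.1 * G ^+ u.2)).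
  move=> t; have [q [r [y [sq hy e]]]] := F_expansion w n (z t).
  exists (fun u : U => (q u.1)`_u.2).
  suff -> : z t - \sum_(u : U) (q u.1)`_u.2 *: (F ^+ u.1 * G ^+ u.2)
      = F ^+ n * r + y.
    by apply: filtD hy; rewrite mulrC; apply/filtMl; have [] := hasval_expF n.
  rewrite e -(pair_bigA _ (fun (s : 'I_n) (j : 'I_(ell w)) =>
    (q s)`_j *: (F ^+ s * G ^+ j))) /=.
  suff -> : \sum_(s < n) F ^+ s * pev (q s) =
      \sum_(s < n) \sum_(j < ell w) (q s)`_j *: (F ^+ s * G ^+ j) by ring.
  apply: eq_bigr => s _; rewrite (pev_expand (sq s)) big_distrr /=.
  by apply: eq_bigr => j _; rewrite scalerAr.
have ltUT : (#|U| < #|T|)%N.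
  rewrite card_prod card_tagged !card_ord /= sumnE big_map big_enum /=.
  rewrite (eq_bigr (fun k => n * omega k - n0)%N); last by move=> k; rewrite card_ord.
  rewrite (eq_bigl xpredT) //.
  have le1 : (\sum_k n * omega k <= \sum_k (n * omega k - n0) + \sum_(k < d) n0)%N.
    by rewrite -big_split /=; apply: leq_sum => k _; rewrite addnC -leq_subLR.
  move: le1; rewrite -big_distrr sum_nat_const card_ord /=.
  have : (n * (ell w).+1 <= n * N)%N by rewrite leq_mul2l lt_ell orbT.
  rewrite N_sum.
  have en : n = (d * n0).+1 by [].
  rewrite mulnS {1}en; move: (n * _)%N (n * _)%N (\sum_k (_ - _))%N => X Y S; lia.
have [u [[t0 ut0] uc]] := row_dependence c ltUT.
(* Pick a term of least order among those with nonzero coefficient. In its branch no other term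
   contributes at that order, which contradicts the relation modulo R(n omega). *)
have [t ut tmin] : exists2 t, u t != 0 &
    forall t', u t' != 0 -> (tagged t <= tagged t')%N.
  by case: (arg_minnP (P := fun t => u t != 0) (fun t : T => nat_of_ord (tagged t)) ut0)
    => t ut tmin; exists t.
have : filt w (\sum_t u t *: z t).
  suff -> : \sum_t u t *: z t =
      \sum_t u t *: (z t - \sum_v c t v *: (F ^+ v.1 * G ^+ v.2)).
    elim/big_ind: _ => [|x y|i _]; [exact: filt0 | exact: filtD | exact/filtZ/cT].
  under [RHS]eq_bigr do rewrite scalerBr.
  rewrite sumrB; set s := (X in _ - X); suff -> : s = 0 by rewrite subr0.
  rewrite /s; under eq_bigr do rewrite scaler_sumr.
  rewrite exchange_big big1 //= => v _.
  under eq_bigr do rewrite scalerA.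
  by rewrite -scaler_suml uc scale0r.
move/(_ (tag t) (n0 + tagged t)%N); rewrite ffunE rmorph_sum fps_sumE.
rewrite (bigD1 t) //= big1 ?addr0 => [|t' tt'].
  rewrite compZ => h; have [_ _ /negP[]] := zT t.
  suff /h/eqP : (n0 + tagged t < n * omega (tag t))%N by rewrite mulf_eq0 (negPf ut).
  by have := ltn_ord (tagged t); lia.
have [-> |ut'] := eqVneq (u t') 0; first by rewrite compZ mul0r.
have [k0 le0 _] := zT t'; rewrite compZ.
have [ek|/k0->] := eqVneq (tag t) (tag t'); last by rewrite mulr0.
have -> : comp (tag t) (z t') = comp (tag t') (z t') by rewrite ek.
rewrite le0 ?mulr0 // ltn_add2l ltn_neqAle tmin // andbT.
apply: contra tt' => /eqP ev; apply/eqP.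
case: t ek ev {ut tmin} => k i; case: t' {ut' k0 le0} => k' i' /= ek.
by case: _ / ek i' => i' ev; congr existT; apply: ord_inj.
Qed.

Lemma ell_leN a : (ell a <= N)%N.
Proof.
have [p sp hp] := char_poly_exists a.
by rewrite -ltnS -sp; apply: ell_min; rewrite // -size_poly_gt0 sp.
Qed.

Lemma ell_ltN a : in_apery a -> (ell a < N)%N.
Proof. by move=> /ell_lt_bump h; apply: leq_trans h (ell_leN _). Qed.

Lemma ell_bump_step a k r : filt a (F * r) -> lead a k (F * r) != 0 ->
  (ell (bump_vec a [set k]%SET) <= ell a)%N.
Proof. by move=> hr lr; apply: ell_sub => x; apply: F_filt_step lr. Qed.

(** Induction on the distance to some [g] with ell(g) at least N. If the generic value of R(a) is
    the value of a multiple of [F], raising one coordinate still below [g] keeps [ell]. *)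
Lemma apery_above a : (ell a < N)%N ->
  exists b, [/\ forall k, (a k <= b k)%N, in_apery b & ell b = ell a].
Proof.
have [g gN] := ell_large.
have [n] := ubnP (\sum_k (g k - a k))%N.
elim: n => // n IH in a *; rewrite ltnS => an aN.
have [b [ab fab xb]] := generic_val a.
have eb : ell b = ell a by apply/eqP; rewrite eqn_leq (ell_filt fab) (ell_le ab).
have [[r hr]|nE] := pselect (exists r, hasval (F * r) b); last by exists b.
have [k bk] : exists k, (b k < g k)%N.
  apply: contrapT => nk; move: aN; rewrite -eb ltnNge (leq_trans gN) //.
  by apply: ell_le => k; rewrite leqNgt; apply/negP => kk; apply: nk; exists k.
pose c := bump_vec b [set k]%SET.
have bc : forall l, (b l <= c l)%N by move=> l; apply: bump_vec_le.
have ec : ell c = ell a.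
  rewrite -eb; apply/eqP; rewrite eqn_leq (ell_le bc) andbT.
  by apply: ell_bump_step (proj1 hr) _; apply: (proj2 hr).
have [||e [ce he ee]] := IH c.
- apply: leq_trans an; rewrite (bigD1 k) //= [X in (_ < X)%N](bigD1 k) //=.
  rewrite -addSn leq_add //.
    by rewrite /c ffunE inE eqxx; have := ab k; lia.
  by apply: leq_sum => l _; rewrite leq_sub2l // (leq_trans (ab l)) // bc.
- by rewrite ec.
exists e; split; rewrite ?ee // => l.
by apply: leq_trans (ce l); apply: leq_trans (bc l).
Qed.

Lemma generic_F a : (forall k, exists2 r, filt a (F * r) & lead a k (F * r) != 0) ->
  exists r, hasval (F * r) a.
Proof.
move=> h.
have [|||k _|z [hz [r ez]] lz] := @generic_lead _ _ _ comp infK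
    (fun z => filt a z /\ exists r, z = F * r) a predT.
- move=> x y [hx [r ex]] [hy [s ey]]; split; first exact: filtD.
  by exists (r + s); rewrite ex ey mulrDr.
- move=> s x [hx [r ex]]; split; first exact: filtZ.
  by exists (s *: r); rewrite ex scalerAr.
- exists 0; split; first exact: filt0.
  by exists 0; rewrite mulr0.
- by have [r hr lr] := h k; exists (F * r) => //; split=> //; exists r.
by exists r; rewrite -ez; split=> // k; apply: lz.
Qed.

(** Equal codimensions let an element of value [a] be written F r + y with y in R(b_j); at a
    coordinate raised by b_j, F r keeps the nonzero leading coefficient. If all coordinates are
    raised, [generic_F] gives a multiple of [F] of value [a]. *)
Lemma apery_no_cover (I : Type) a (b : I -> vec) : in_apery a ->
  (forall j k, (a k <= b j k)%N) -> (forall j, ell (b j) = ell a) ->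
  ~ (forall k, exists j, (a k < b j k)%N).
Proof.
move=> ha ab eb cover; apply: (proj2 ha); apply: generic_F => k.
have [j abk] := cover k; have [[x [hx lx]] _] := ha.
have sub : forall z, F_filt (b j) z -> F_filt a z.
  by apply: F_filt_sub => z; apply: filt_le.
have [r [y [hy e]]] := F_filt_ell sub (eq_leq (eb j)) (F_filt_filt hx).
exists r; first by rewrite -[F * r](addrK y) -e; apply: filtB (filt_le _ hy).
by move: (lx k); rewrite e leadD [lead a k y]hy ?addr0.
Qed.

(* Below, [a] is a complete infimum of elements of the Apery set raised on the parts of a
   partition of the coordinates: one part P is maximal, containing a coordinate where FR
   contributes nothing, such that ell (a + 1_P) <= ell a + 1; the remaining coordinates are
   grouped when their leading coefficients are proportional on R(a). *)
Section CompleteInfimum.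

Variable a : vec.
Hypothesis a_apery : in_apery a.
Hypothesis a_jump : ((ell a).+1 < ell (bump_vec a [set: 'I_d]%SET))%N.

(** This keeps the coordinates outside [P] fixed when [generic_val] is applied to a + 1_P. *)
Let flat P := forall k, k \notin P ->
  exists2 x, filt (bump_vec a P) x & lead a k x != 0.

Let raises P b :=
  [/\ forall k, k \notin P -> b k = a k, forall k, k \in P -> (a k < b k)%N,
      in_apery b & (ell b <= (ell a).+1)%N].

Lemma flat_val P : flat P -> (ell (bump_vec a P) <= (ell a).+1)%N ->
  (forall b r, hasval (F * r) b -> filt (bump_vec a P) (F * r) ->
    (forall k, k \notin P -> lead a k (F * r) != 0) -> False) ->
  exists b, raises P b.
Proof.
move=> flP eP nE; have [b [ab fab xb]] := generic_val (bump_vec a P).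
have bP k : k \notin P -> b k = a k.
  move=> kP; have [x hx lx] := flP k kP.
  have := ab k; rewrite ffunE (negPf kP) addn0 => le_ab.
  apply/eqP; rewrite eqn_leq le_ab andbT leqNgt; apply/negP => /(fab _ hx).
  exact/eqP.
exists b; split=> //.
- by move=> k kP; have := ab k; rewrite ffunE kP addn1.
- split=> // -[r hr]; apply: (nE b r) => //; first exact: filt_le (proj1 hr).
  by move=> k kP; rewrite /lead -bP //; apply: (proj2 hr).
- by apply: leq_trans eP; apply: ell_filt.
Qed.

Lemma F_null_coord : exists i, forall r, filt a (F * r) -> lead a i (F * r) = 0.
Proof.
apply: contrapT => ni; apply: (proj2 a_apery); apply: generic_F => k.
apply: contrapT => nk; apply: ni; exists k => r hr; apply/eqP/contraT => lr.
by case: nk; exists r.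
Qed.

Lemma apery_cover : exists r (b : 'I_r -> vec) (P : 'I_r -> {set 'I_d}),
  [/\ (1 < r <= d)%N, forall j, raises (P j) (b j),
      forall j, P j != finset.set0 /\ P j != [set: 'I_d]%SET,
      forall j j' k, k \in P j -> k \in P j' -> j = j' &
      forall k, exists j, k \in P j].
Proof.
have [i iP] := F_null_coord; have [[x0 [h0 l0]] _] := a_apery.
pose ok P := (i \in P) && (ell (bump_vec a P) <= (ell a).+1)%N.
have ok1 : ok [set i]%SET by rewrite /ok inE eqxx ell_bump1.
have [P /andP[inP eP] Pmax] := arg_maxnP (fun P : {set 'I_d} => #|P|) ok1.
(* By maximality of [P], adding any coordinate pushes [ell] beyond ell(a) + 1. *)
have Pext k : k \notin P -> (ell (bump_vec a (k |: P)%SET) <= (ell a).+1)%N -> False.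
  move=> kP ek; have := Pmax (k |: P)%SET; rewrite /ok ek inE inP orbT => /(_ isT).
  by rewrite /= cardsU1 kP add1n ltnn.
have flP : flat P.
  move=> k kP; apply: contrapT => nx; apply: (Pext k kP); apply: leq_trans eP.
  apply: ell_filt => x hx; apply: filt_bump => [|l]; first exact: filt_unbump hx.
  rewrite 2!inE => /predU1P[->|lP]; last exact: lead_bump hx lP.
  by apply/eqP/contraT => lx; case: nx; exists x.
have [k0 k0P] : exists k, k \notin P.
  apply: contrapT => nk; move: a_jump; rewrite ltnNge -(_ : P = [set: 'I_d]%SET) ?eP //.
  by apply/finset.setP => l; rewrite inE; apply: contrapT => /negP lP; apply: nk; exists l.
have [bP hbP] : exists b, raises P b.
  (* If a multiple of [F] had the generic value, [ell_bump_step] would allow [P] to be enlarged by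
     [k0]. *)
  apply: flat_val => // b r _ hr lr.
  apply: (Pext k0 k0P); apply: leq_trans eP.
  have -> : bump_vec a (k0 |: P)%SET = bump_vec (bump_vec a P) [set k0]%SET.
    apply/ffunP => l; rewrite !ffunE !inE.
    by have [->|_] := eqVneq l k0; rewrite ?(negPf k0P) //= !addn0.
  apply: ell_bump_step hr _.
  by rewrite /lead ffunE (negPf k0P) addn0; apply: lr.
(* Coordinates are equivalent when their leading coefficients, normalized by [x0] of value [a],
   agree on all of R(a). *)
pose rat k x := lead a k x / lead a k x0.
pose cls k : {set 'I_d} := [set l | `[< forall x, filt a x -> rat l x = rat k x >]]%SET.
have clsP k l : l \in cls k <-> forall x, filt a x -> rat l x = rat k x.
  by rewrite inE; split=> /asboolP.
have rat0 k x : (rat k x == 0) = (lead a k x == 0).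
  by rewrite mulf_eq0 invr_eq0 (negPf (l0 k)) orbF.
have cls_P k l : k \notin P -> l \in cls k -> l \notin P.
  move=> kP /clsP lk; apply/negP => lP; have [x hx] := flP k kP.
  rewrite -rat0 -lk ?rat0 ?(lead_bump hx lP) ?eqxx //; exact: filt_unbump hx.
have [bc hbc] : exists bc, forall k, k \notin P -> raises (cls k) (bc k).
  suff : forall k, exists b, k \notin P -> raises (cls k) b.
    by case/choice=> bc; exists bc.
  move=> k; have [kP|kP] := boolP (k \in P); first by exists a.
  suff [b hb] : exists b, raises (cls k) b by exists b.
  apply: flat_val.
  - move=> l lk; have [x hx lx] : exists2 x, filt a x & rat l x != rat k x.
      apply: contrapT => nx; move/negP: lk; apply; apply/clsP => x hx.
      by apply/eqP/contraT => lx; case: nx; exists x.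
    (* This combination loses its leading coefficient on the class of [k] but not at [l]. *)
    exists (x - rat k x *: x0).
      apply: filt_bump => [|m /clsP mk]; first exact/filtB/filtZ.
      by rewrite leadD leadN leadZ -mk // /rat divfK ?subrr.
    rewrite leadD leadN leadZ subr_eq0; apply: contra lx => /eqP e.
    by rewrite {1}/rat e mulfK.
  (* Killing the leading coefficient at [k] kills it on the whole class, so raising [k] alone gives
     the bound. *)
  - apply: leq_trans (ell_bump1 a k); apply: ell_filt => x hx.
    apply: filt_bump => [|m /clsP mk]; first exact: filt_unbump hx.
    apply/eqP; rewrite -rat0 mk ?rat0 ?(lead_bump hx) ?inE //; exact: filt_unbump hx.
  (* The coordinate [i] lies outside the class, yet every multiple of [F] in R(a) has zero
     coefficient there. *)
  - move=> b r _ hr lr; have ik : i \notin cls k.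
      by apply/negP => /(cls_P _ _ kP); rewrite inP.
    by have := lr i ik; rewrite iP ?eqxx //; apply: filt_unbump hr.
pose rep k := if k \in P then P else cls k.
have repk k : k \in rep k by rewrite /rep; case: ifP => // _; apply/clsP.
have rep_eq k l : l \in rep k -> rep l = rep k.
  rewrite /rep; case: (boolP (k \in P)) => kP; first by move->.
  move=> lk; rewrite (negPf (cls_P _ _ kP lk)); apply/finset.setP => m.
  move/clsP: lk => lk; apply/idP/idP => /clsP h; apply/clsP => x hx.
    by rewrite h // lk.
  by rewrite h // lk.
have rep_val k : exists b, raises (rep k) b.
  by rewrite /rep; case: (boolP (k \in P)) => kP; [exists bP | exists (bc k); apply: hbc].
have [b hb] := choice rep_val.
pose parts := [set rep k | k in 'I_d]%SET.
have /choice[idx hidx] : forall j : 'I_#|parts|, exists k, enum_val j = rep k.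
  by move=> j; have /imsetP[k _ ->] := enum_valP j; exists k.
exists #|parts|, (fun j => b (idx j)), (fun j => rep (idx j)); split.
- apply/andP; split; last by rewrite -[X in (_ <= X)%N]card_ord leq_imset_card.
  (* The parts of [i] and of [k0] differ, which gives at least two. *)
  rewrite (cardsD1 (rep i)) imset_f // add1n ltnS card_gt0.
  apply/set0Pn; exists (rep k0); rewrite !inE imset_f // andbT.
  by rewrite /rep inP (negPf k0P); apply: contra k0P => /eqP <-; apply/clsP.
- by move=> j; apply: hb.
- move=> j; split; first by apply/set0Pn; exists (idx j).
  apply/eqP => eT; have := rep_eq (idx j); rewrite eT => h.
  have := h k0; have := h i; rewrite !inE => /(_ isT) ei /(_ isT).
  rewrite -ei /rep inP (negPf k0P) => e; move: k0P; rewrite -e.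
  by move/negP; apply; apply/clsP.
- move=> j j' k /rep_eq e /rep_eq e'; apply: enum_val_inj.
  by rewrite !hidx -e -e'.
- move=> k; have kp : rep k \in parts by apply: imset_f.
  by exists (enum_rank_in kp (rep k)); rewrite -hidx enum_rankK_in.
Qed.

End CompleteInfimum.

(** * The levels as fibres of [ell] *)

Local Open Scope classical_set_scope.

Local Notation S := [set a | exists x, hasval x a].
Local Notation remaining n := [set a | in_apery a /\ (ell a <= n)%N].

(** An element with smaller [ell] is either not maximal, by [apery_above], or a complete infimum, by
    [apery_cover]; one with [ell] equal to [n] is neither, by [ell_lt_bump] and [apery_no_cover]. *)
Lemma step_D_ell n : (n < N)%N ->
  step_D S (remaining n) = [set a | in_apery a /\ ell a = n].
Proof.
move=> nN; apply/seteqP; split=> a /=.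
  move=> [[[ha an] amax] nC]; split=> //; apply/eqP; rewrite eqn_leq an leqNgt.
  apply/negP => lt_an.
  have [le_n|gt_n] := leqP (ell (bump_vec a [set: 'I_d]%SET)) n.
    have [b [ab hb eb]] := apery_above (leq_ltn_trans le_n nN).
    have lt_ab k : (a k < b k)%N by have := ab k; rewrite ffunE inE addn1.
    have eba : b = a by apply: amax; [rewrite /= eb | right].
    by have := ell_lt_bump ha; rewrite -eb eba ltnn.
  have [|r [b [P [hr hb hP disj cov]]]] := apery_cover ha.
    exact: leq_ltn_trans lt_an gt_n.
  (* An element strictly above b_j dominates a + (1,...,1), whose [ell] exceeds [n]; so b_j is
     maximal. *)
  have bB j : step_B (remaining n) (b j).
    have [out inn ap le] := hb j; split=> [|b' [hb' eb'] [//|lt_b]].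
      by split=> //; apply: leq_trans lt_an.
    suff /ell_le le_b : forall k, (bump_vec a [set: 'I_d]%SET k <= b' k)%N.
      by move: gt_n; rewrite ltnNge (leq_trans le_b eb').
    move=> k; rewrite ffunE inE addn1; apply: leq_ltn_trans (lt_b k).
    by case: (boolP (k \in P j)) => [/inn/ltnW|/out->].
  apply: nC; split; first by split.
  exists r, b; split=> //; split=> //; first by case/andP: hr.
  (* The definition records where b_j agrees with [a], hence the complements: disjoint parts give
     the pairwise infima, covering gives the empty intersection. *)
  exists (fun j => ~: P j)%SET; split.
  - move=> j; have [out inn [xb _] _] := hb j; have [P0 PT] := hP j; split.
    + by rewrite -finset.setCT (inj_eq (can_inj finset.setCK)).
    + rewrite finset.properEneq finset.subsetT andbT.
      by rewrite -finset.setC0 (inj_eq (can_inj finset.setCK)).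
    + split=> // k; rewrite inE; [exact: out | by rewrite negbK => /inn].
  - move=> j j' jj'; apply/ffunP => k; rewrite ffunE.
    have [out inn _ _] := hb j; have [out' inn' _ _] := hb j'.
    have [kP|kP] := boolP (k \in P j); last first.
      rewrite (out k kP); have [/inn' h|/out'->] := boolP (k \in P j').
        by rewrite (minn_idPl (ltnW h)).
      by rewrite minnn.
    rewrite out' ?(minn_idPr (ltnW (inn k kP))) //.
    by apply: contra jj' => kP'; rewrite (disj _ _ _ kP kP').
  - apply/finset.setP => k; rewrite !inE; have [j kj] := cov k.
    by apply/negP => /bigcapP/(_ j isT); rewrite inE kj.
move=> [ha ea]; split.
  split=> [|b [hb bn] [<-//|lt_ab]]; first by rewrite /= ea.
  have : (ell (bump_vec a [set: 'I_d]%SET) <= ell b)%N.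
    by apply: ell_le => k; rewrite ffunE inE addn1.
  by rewrite leqNgt (leq_ltn_trans bn) // -ea; apply: ell_lt_bump.
move=> [_ [r [b [hr [_ _ hb [P [hP _ capP]]]]]]].
have ab j k : (a k <= b j k)%N.
  have [_ _ [_ h1 h2]] := hP j.
  by case: (boolP (k \in P j)) => [/h1->|/h2/ltnW].
apply: (apery_no_cover ha ab).
  move=> j; apply/eqP; rewrite eqn_leq (ell_le (ab j)) andbT ea.
  by have [[_ ?] _] := hb j.
move=> k; have /finset.setP/(_ k) := capP; rewrite [in RHS]inE => /negbT.
move=> kcap; apply: contrapT => nj; move/negP: kcap; apply; apply/bigcapP => j _.
by apply: contraT => kj; case: nj; exists j; have [_ _ [_ _ /(_ k kj)]] := hP j.
Qed.

Lemma apery_in : apery S omega = [set a | in_apery a].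
Proof.
apply/seteqP; split=> a /= [Sa nE]; split=> //.
  move=> [r hr]; apply: nE; have [|b hb] := @hasval_ex _ _ _ comp r.
    by move=> k; have := hasval_neq0 k hr; rewrite rmorphM mulf_eq0 => /norP[].
  by exists b; [exists r | apply: hasval_inj hr (hasvalM F_val hb)].
by move=> [b [r hr] eab]; apply: nE; exists r; rewrite eab; apply: hasvalM.
Qed.

(** Each step strips the largest remaining value of [ell], starting from N - 1. *)
Lemma remaining_ell m : (m < N)%N ->
  [set a | in_apery a] `\` removed S [set a | in_apery a] m = remaining (N.-1 - m).
Proof.
elim: m => [|m IH] mN.
  apply/seteqP; split=> a /=; last by move=> [? _]; split.
  move=> [ha _]; split=> //; have := ell_ltN ha. by lia.
have {}IH := IH (ltnW mN).
rewrite [removed _ _ _]/= IH step_D_ell; last by lia.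
rewrite -setDDl IH; apply/seteqP; split=> a /=.
  move=> [[ha le_a] ne]; split=> //; have : ell a <> (N.-1 - m)%N by move=> e; apply: ne.
  by lia.
by move=> [ha le_a]; split; [split=> //; lia | move=> [_]; lia].
Qed.

Lemma level_ell i : (i < N)%N -> level S omega i = [set a | in_apery a /\ ell a = i].
Proof.
move=> iN; rewrite /level /D_set -N_sum apery_in remaining_ell; last by lia.
(* D^(N - i) is formed after N - i - 1 removals. *)
have -> : (N.-1 - (N - i).-1 = i)%N by lia.
exact: step_D_ell.
Qed.

(** * Approximation by polynomials in [F] and [G] *)

(* The module generated by 1, G, ..., G^(j-1) over the polynomials in F. *)
Inductive polspan (j : nat) : R -> Prop :=
| polspan_0 : polspan j 0
| polspan_S (q : {poly K}) x :
    (size q <= j)%N -> polspan j x -> polspan j (pev q + F * x).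

Lemma polspanD j x y : polspan j x -> polspan j y -> polspan j (x + y).
Proof.
move=> hx; elim: hx y => [|q {}x sq hx IH] y; first by rewrite add0r.
case=> [|q' {}y sq' hy]; first by rewrite addr0; exact: polspan_S.
have -> : pev q + F * x + (pev q' + F * y) = pev (q + q') + F * (x + y).
  by rewrite rmorphD /=; ring.
by apply/polspan_S/IH => //; rewrite (leq_trans (size_polyD _ _)) // geq_max sq.
Qed.

Lemma polspanZ j (s : K) x : polspan j x -> polspan j (s *: x).
Proof.
elim=> [|q {}x sq hx IH]; first by rewrite scaler0; exact: polspan_0.
have -> : s *: (pev q + F * x) = pev (s *: q) + F * (s *: x).
  by rewrite -mul_polyC rmorphM /= horner_algC mulr_algl scalerDr scalerAr.
by apply: polspan_S IH; rewrite (leq_trans (size_scale_leq _ _)).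
Qed.

Lemma polspan_sum n (q : nat -> {poly K}) j : (forall s, (size (q s) <= j)%N) ->
  polspan j (\sum_(s < n) F ^+ s * pev (q s)).
Proof.
elim: n q => [|n IH] q sq; first by rewrite big_ord0; exact: polspan_0.
rewrite big_ord_recl expr0 mul1r.
rewrite (eq_bigr (fun s : 'I_n => F * (F ^+ s * pev (q s.+1)))); last first.
  by move=> s _; rewrite exprS mulrA.
rewrite -big_distrr /=; apply: polspan_S => //.
by apply: (IH (fun s => q s.+1)).
Qed.

Lemma polspan_filt b j x : (ell b <= j)%N -> exists2 u, polspan j u & filt b (x - u).
Proof.
move=> bj; have [n hn] := filt_expF b; have [q [r [y [sq hy ->]]]] := F_expansion b n x.
exists (\sum_(s < n) F ^+ s * pev (q s)).
  by apply: polspan_sum => s; apply: leq_trans bj.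
set u := \sum_(s < n) _; have -> : u + F ^+ n * r + y - u = F ^+ n * r + y by ring.
exact: filtD.
Qed.

(** Approximating modulo R(a + e_k) matches the leading coefficient at [k]; a generic combination
    handles all coordinates at once. *)
Lemma polspan_val a j : (exists x, hasval x a) ->
  (forall k, (ell (bump_vec a [set k]%SET) <= j)%N) ->
  exists2 u, polspan j u & hasval u a.
Proof.
move=> [x [hx lx]] le_j.
have [||||u [hu fu] lu] := @generic_lead _ _ _ comp infK
    (fun u => polspan j u /\ filt a u) a predT.
- by move=> u v [hu fu] [hv fv]; split; [exact: polspanD | exact: filtD].
- by move=> s u [hu fu]; split; [exact: polspanZ | exact: filtZ].
- by exists 0; split; [exact: polspan_0 | exact: filt0].
- move=> k _; have [u hu xu] := polspan_filt x (le_j k).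
  exists u; first by split=> //; rewrite -[u](subKr x); apply/filtB/(filt_unbump xu).
  have := lead_bump (k := k) xu; rewrite inE leadD leadN => /(_ (eqxx _))/subr0_eq <-.
  exact: lx.
by exists u => //; split=> // k; apply: lu.
Qed.

(** The coefficient of [G ^+ j] in [x] is a polynomial in [F]: its constant term is [s], and the
    rest is absorbed by a multiple of the monic element [G ^+ j + phi]. *)
Lemma polspan_top j x phi : polspan j phi -> polspan j.+1 x ->
  exists (s : K) u, polspan j (x - s *: G ^+ j - F * (u * (G ^+ j + phi))).
Proof.
move=> hphi; elim=> [|q {}x sq hx [s [u IH]]].
  by exists 0, 0; rewrite scale0r !mul0r mulr0 !subr0; exact: polspan_0.
exists q`_j, (s%:A + F * u).
have -> : pev q = pev (\poly_(l < j) q`_l) + q`_j *: G ^+ j.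
  rewrite (pev_expand sq) big_ord_recr (pev_expand (size_poly _ _)) /=.
  by congr (_ + _); apply: eq_bigr => l _; rewrite coef_poly ltn_ord.
set p := \poly_(l < j) _; set y := G ^+ j.
have -> : pev p + q`_j *: y + F * x - q`_j *: y - F * ((s%:A + F * u) * (y + phi)) =
    pev p + F * ((x - s *: y - F * (u * (y + phi))) + (- s) *: phi).
  by rewrite -[s *: y]mulr_algl -[- s *: phi]mulr_algl scaleNr; ring.
by apply: polspan_S; [exact: size_poly | exact/polspanD/polspanZ].
Qed.

(** * The K[[F]]-modules R_j and the values of monic elements *)

Lemma power_series_in_cons (s : K) x :
  power_series_in F x -> power_series_in F (s%:A + F * x).
Proof.
move=> [c hc]; exists (fun n => if n is m.+1 then c m else s) => -[|n].
  by exists (s%:A + F * x); rewrite big_ord0 expr0 mul1r add0r.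
have [r ->] := hc n; exists r; rewrite big_ord_recl expr0 mulrDr big_distrr /= addrA.
rewrite exprS mulrA; congr (_ + _ + _); apply: eq_bigr => k _.
by rewrite exprS scalerAr.
Qed.

Lemma power_series_in0 : power_series_in F 0.
Proof.
exists (fun=> 0) => n; exists 0; rewrite mulr0 addr0 big1 // => k _.
by rewrite scale0r.
Qed.

Lemma polspan_span_upto j x : polspan j.+1 x -> span_upto F G j x.
Proof.
elim=> [|q {}x sq _ [y [hy ->]]].
  exists (fun=> 0); split=> [k|]; first exact: power_series_in0.
  by rewrite big1 // => k _; rewrite mul0r.
exists (fun k : 'I_j.+1 => (q`_k)%:A + F * y k); split=> [k|]; first exact: power_series_in_cons.
rewrite (pev_expand sq) big_distrr -big_split /=; apply: eq_bigr => k _.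
by rewrite mulrDl mulr_algl mulrA.
Qed.

Lemma span_upto_poly j x : span_upto F G j x ->
  exists (q : {poly K}) r, (size q <= j.+1)%N /\ x = pev q + F * r.
Proof.
move=> [y [hy ->]]; have /choice[s hs] : forall k : 'I_j.+1,
    exists s : K, exists r, y k = s%:A + F * r.
  move=> k; have [c /(_ 1%N)[r ->]] := hy k; exists (c 0%N), r.
  by rewrite big_ord1 expr0.
have [r hr] := choice hs; exists (\poly_(l < j.+1) s (inord l)), (\sum_(k < j.+1) r k * G ^+ k).
split; first exact: size_poly.
rewrite (pev_expand (size_poly _ _)) big_distrr -big_split /=; apply: eq_bigr => k _.
by rewrite coef_poly ltn_ord inord_val hr mulrDl mulr_algl mulrA.
Qed.

(** The polynomial part lies in F R + R(a) and has degree below ell(a), so it vanishes; what is left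
    is a multiple of [F], whose value cannot be [a]. *)
Lemma apery_span_upto a j : in_apery a -> (j < ell a)%N ->
  ~ exists2 x, span_upto F G j x & hasval x a.
Proof.
move=> [_ nE] ja [x /span_upto_poly[q [r [sq ex]]] hx].
have : F_filt a (pev q).
  rewrite -[pev q](addrK (F * r)) -ex; apply: F_filtB (F_filtF _ _).
  exact: F_filt_filt (proj1 hx).
have [q0 _|q0 /ell_min/(_ q0)] := eqVneq q 0; last first.
  by rewrite ltnNge (leq_trans sq ja).
by apply: nE; exists r; move: hx; rewrite ex q0 rmorph0 add0r.
Qed.

(** An element of degree at most j + 1 in [G] attains [a]. Dividing it by a monic y in R(a) leaves s
    G^(j+1) + phi of the same value, and [apery_span_upto] forces s to be nonzero. *)
Lemma apery_monic a j : in_apery a -> ell a = j.+1 ->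
  exists2 phi, span_upto F G j phi & hasval (G ^+ j.+1 + phi) a.
Proof.
move=> ha ea.
have [u hu fu] := polspan_filt (G ^+ j.+1) (eq_leq ea).
set y := G ^+ j.+1 - u in fu.
have hNu : polspan j.+1 (- u) by rewrite -scaleN1r; apply: polspanZ.
have [x hx xa] : exists2 x, polspan j.+2 x & hasval x a.
  by apply: polspan_val (proj1 ha) _ => k; rewrite -ea ell_bump1.
have [s [w hz]] := polspan_top hNu hx; rewrite -/y in hz.
set phi := _ - _ in hz.
have hv : hasval (s *: G ^+ j.+1 + phi) a.
  have -> : s *: G ^+ j.+1 + phi = x - F * (w * y) by rewrite /phi; ring.
  (* Since omega is positive, F w y lies in R(a + (1,...,1)) and does not alter the value. *)
  apply: hasvalD xa _; apply: filtN; apply: filt_le (filtM (proj1 F_val) (filtMl w fu)).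
  by move=> k; rewrite !ffunE inE addnC leq_add2r omega_gt0.
have [s0|s0] := eqVneq s 0.
  case: (@apery_span_upto a j ha); first by rewrite ea.
  by exists phi; [exact: polspan_span_upto | move: hv; rewrite s0 scale0r add0r].
exists (s^-1 *: phi); first exact/polspan_span_upto/polspanZ.
have -> : G ^+ j.+1 + s^-1 *: phi = s^-1 *: (s *: G ^+ j.+1 + phi).
  by rewrite [RHS]scalerDr scalerA mulVf // scale1r.
split=> [|k]; first exact: filtZ (proj1 hv).
by rewrite leadZ mulf_neq0 ?invr_eq0 //; apply: (proj2 hv).
Qed.

(** If every ell(a + e_k) were at most j + 1, [polspan_val] would attain [a] in R_j. This rules out
    both ell(a) <= j and a multiple of [F] of value [a]. *)
Lemma monic_apery a j phi : span_upto F G j phi -> hasval (G ^+ j.+1 + phi) a ->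
  ~ (exists2 x, span_upto F G j x & hasval x a) -> in_apery a /\ ell a = j.+1.
Proof.
move=> /span_upto_poly[q [r [sq ephi]]] hv nv.
have nle : ~ (forall k, (ell (bump_vec a [set k]%SET) <= j.+1)%N).
  move=> le_j; have [|x hx xa] := polspan_val _ le_j; first by exists (G ^+ j.+1 + phi).
  by apply: nv; exists x => //; apply: polspan_span_upto.
have le_a : (ell a <= j.+1)%N.
  have sp : size ('X^(j.+1) + q) = j.+2 by rewrite size_polyDl size_polyXn.
  rewrite -ltnS -sp; apply: ell_min; last by rewrite -size_poly_gt0 sp.
  have -> : pev ('X^(j.+1) + q) = (G ^+ j.+1 + phi) - F * r.
    by rewrite rmorphD rmorphXn /= horner_algX ephi; ring.
  exact/F_filtB/F_filtF/F_filt_filt/(proj1 hv).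
split; last first.
  apply/eqP; rewrite eqn_leq le_a leqNgt; apply/negP => lt_a.
  by apply: nle => k; apply: leq_trans (ell_bump1 a k) _.
split; first by exists (G ^+ j.+1 + phi).
move=> [z [hz lz]]; apply: nle => k; apply: leq_trans le_a.
exact: ell_bump_step hz (lz k).
Qed.

(** With ell(a) = 0 the zero element approximates 1, so 1 lies in R(a). Conversely N > 0 provides a
    coordinate, where a multiple of [F] cannot have order 0. *)
Lemma apery0 a : (in_apery a /\ ell a = 0%N) <-> ((0 < N)%N /\ a = [ffun => 0%N]).
Proof.
split=> [[ha ea]|[Ngt0 ->]].
  have := ell_ltN ha; rewrite ea; split=> //.
  have [u] := polspan_filt 1 (eq_leq ea).
  have u0 : forall v, polspan 0 v -> v = 0.
    move=> v; elim=> // q x; rewrite leqn0 size_poly_eq0 => /eqP-> _ ->.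
    by rewrite rmorph0 mulr0 addr0.
  move/u0->; rewrite subr0 => h1; apply/ffunP => k; rewrite ffunE.
  have := hasval_lt (@hasval1 _ _ _ comp) h1 k.
  by rewrite ffunE leqn0 => /eqP.
split; last first.
  suff : (ell [ffun => 0%N] < size (1%R : {poly K}))%N.
    by rewrite size_poly1 ltnS leqn0 => /eqP.
  by apply: ell_min (oner_neq0 _); rewrite rmorph1; apply/F_filt_filt/filt_const0.
split; first by exists 1; exact: hasval1.
move=> [r [_ lr]]; have [k _] : exists k : 'I_d, true.
  apply: contrapT => nk; move: Ngt0; rewrite N_sum big1 // => k _.
  by case: nk; exists k.
move/eqP: (lr k); apply; rewrite /lead ffunE -[F * r]mulr1.
have := filtM (proj1 F_val) (@filt_const0 _ _ _ comp r).
by rewrite mulr1; apply; rewrite !ffunE addn0.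
Qed.

End Levels.

(** * Branches of the curve: components, conductor and zero divisors *)

Section Curve.

Context (K : fieldType) (R : comAlgType K) (c d : nat) (C : curve_product R c d).

Definition comp (i : 'I_d) : {lrmorphism R -> fps K} :=
  (param C i \o to_branch C i \o proj C (factor_of C i)).

Local Notation H := (branch_eqn C).

Definition branch_comp (i : 'I_d) : {lrmorphism fps2 K -> fps K} :=
  (param C i \o branch_pi C i).

Lemma branch_comp_eq0 i f : branch_comp i f = 0 <-> exists a, f = a * H i.
Proof.
have [_ /(_ f) <-] := branch_piP C i; have [inj _] := paramP C i.
by split=> [/= e|/= ->]; [apply: inj; rewrite e rmorph0 | rewrite rmorph0].
Qed.

Lemma branch_comp_neq0 i k : i != k -> factor_of C i = factor_of C k ->
  branch_comp k (H i) != 0.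
Proof.
move=> ik eik; apply/eqP => /branch_comp_eq0[a ea].
have [_ nu _] := branch_eqn_irreducible C k.
move/negP: nu; apply; apply: (branch_eqn_coprime ik eik).
  by exists a; rewrite mulrC.
by exists 1; rewrite mulr1.
Qed.

Lemma compM i x y : comp i (x * y) = comp i x * comp i y.
Proof. exact: rmorphM. Qed.

Lemma comp_lift i x f : proj C (factor_of C i) x = factor_pi C _ f ->
  comp i x = branch_comp i f.
Proof. by move=> /= ->; rewrite to_branchP. Qed.

(** The kernel of [branch_comp i] is a prime ideal generated by the branch equation. A lift killed
    by all branches of its factor is divisible by their equations one after another, hence by the
    product. *)
Lemma comp_inj x : (forall i, comp i x = 0) -> x = 0.
Proof.
move=> x0; suff pr0 j : proj C j x = 0.
  have [z [_ uz]] := projP (fun j => 0 : factor C j).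
  by rewrite -(uz x pr0); apply: uz => j; rewrite rmorph0.
have [sur ker] := factor_piP C j.
have [f ef] : exists f : fps2 K, factor_pi C j f = proj C j x := sur _.
have fk i : factor_of C i = j -> branch_comp i f = 0.
  by move=> e; subst j; rewrite -(comp_lift (esym ef)).
rewrite -ef; apply/ker; rewrite -big_enum /=.
have : {subset enum (fun i => factor_of C i == j) <= (fun i => factor_of C i == j)}.
  by move=> i; rewrite mem_enum.
elim: (enum _) (enum_uniq (fun i => factor_of C i == j)) => [|i s IH] /=.
  by exists f; rewrite big_nil mulr1.
move=> /andP[nis us] sub; have [|a ea] := IH us.
  by move=> l ls; apply: sub; rewrite inE ls orbT.
have ij : factor_of C i = j by apply/eqP/sub; rewrite inE eqxx.
have : branch_comp i f = 0 by apply: fk.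
rewrite ea rmorphM rmorph_prod => /eqP; rewrite mulf_eq0 => /orP[/eqP a0|].
  have /branch_comp_eq0[b eb] : branch_comp i a = 0 by [].
  by exists b; rewrite big_cons eb mulrA.
rewrite prodf_seq_eq0 => /hasP[l ls /= l0].
suff /negP[] : branch_comp i (H l) != 0 by [].
apply: branch_comp_neq0; first by apply: contra nis => /eqP <-.
by rewrite ij; apply/eqP/sub; rewrite inE ls orbT.
Qed.

(** For p > 0 and n = q p + r, write n = (q - r) p + r (p + 1); n >= p^2 ensures r <= q. *)
Lemma consecutive_semigroup p n : (p * p <= n)%N ->
  exists u s, n = (u * p + s * p.+1)%N.
Proof.
have [->|p0] := posnP p; first by exists 0%N, n; rewrite muln0 muln1.
move=> le_n; exists (n %/ p - n %% p)%N, (n %% p)%N.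
have lt_r := ltn_pmod n p0.
have le_q : (n %% p <= n %/ p)%N by rewrite (leq_trans (ltnW lt_r)) // leq_divRL.
by rewrite mulnBl mulnS {1}(divn_eq n p); have := leq_mul le_q (leqnn p); lia.
Qed.

Lemma order_exists (f : fps K) : f != 0 ->
  exists n, (forall m, (m < n)%N -> f m = 0) /\ f n != 0.
Proof.
move=> /fps_neq0 h; case: (ex_minnP h) => n fn nmin; exists n; split=> // m mn.
by apply/eqP/contraT => /nmin; rewrite leqNgt mn.
Qed.

Lemma order_expr (f : fps K) p : (forall m, (m < p)%N -> f m = 0) -> f p != 0 ->
  forall u, (forall m, (m < u * p)%N -> (f ^+ u) m = 0) /\ (f ^+ u) (u * p)%N != 0.
Proof.
move=> f0 fp; elim=> [|u [IH0 IHp]]; first by rewrite expr0; split=> //; exact: oner_neq0.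
have [h0 hp] := fps_mul_lead f0 IH0.
by rewrite exprS mulSn; split=> //; rewrite hp mulf_neq0.
Qed.

(* The parameter t is a quotient of elements of the branch, whose orders are therefore
   consecutive integers. *)
Lemma branch_conductor k : exists n0 : nat, forall n, (n0 <= n)%N ->
  exists x, [/\ forall l, l != k -> comp l x = 0,
                forall m, (m < n)%N -> comp k x m = 0 & comp k x n != 0].
Proof.
pose t : fps K := Fps (fun n => (n == 1%N)%:R).
have [inj /(_ (tofrac t)) [/(_ (ex_intro _ t erefl))[[a [b [b0 eab]]] _] _]] := paramP C k.
have nub0 : param C k b != 0 by rewrite -(rmorph0 (param C k)) (inj_eq inj).
have ea : param C k a = t * param C k b.
  apply/eqP; rewrite -tofrac_eq tofracM eab divfK //.
  by rewrite tofrac_eq0.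
have [surj _] := branch_piP C k.
have [fa efa] : exists f, branch_comp k f = param C k a.
  by have [f <-] := surj a; exists f.
have [fb efb] : exists f, branch_comp k f = param C k b.
  by have [f <-] := surj b; exists f.
(* This vanishes on the other branches of the same factor; its order on branch [k] shifts the
   bound. *)
pose h : fps2 K := \prod_(l | (l != k) && (factor_of C l == factor_of C k)) H l.
have h0 : branch_comp k h != 0.
  rewrite rmorph_prod; apply/prodf_neq0 => l /andP[lk /eqP el].
  exact: branch_comp_neq0.
have [p [bp0 bp]] := order_exists nub0; have [e [he0 he]] := order_exists h0.
have t0 m : (m < 1)%N -> t m = 0 by case: m.
have [ap0 ap] := fps_mul_lead t0 bp0; rewrite -ea add1n in ap0 ap.
have {}ap : param C k a p.+1 != 0 by rewrite ap mul1r.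
(* Numerator and denominator of t have orders p + 1 and p, so their products reach every order from
   p^2 on. *)
exists (e + p * p)%N => n len.
have [|u [s eus]] := @consecutive_semigroup p (n - e); first by lia.
pose f := h * (fb ^+ u * fa ^+ s).
have [x [xf _]] := projP
  (fun j => factor_pi C j (if j == factor_of C k then f else 0) : factor C j).
have [g0 gn] : (forall m, (m < n)%N -> branch_comp k f m = 0) /\ branch_comp k f n != 0.
  have [b1 b2] := order_expr bp0 bp u; have [a1 a2] := order_expr ap0 ap s.
  have [m1 m2] := fps_mul_lead b1 a1; have [m3 m4] := fps_mul_lead he0 m1.
  have -> : n = (e + (u * p + s * p.+1))%N by lia.
  have -> : branch_comp k f = branch_comp k h * (param C k b ^+ u * param C k a ^+ s).
    by rewrite -efa -efb -!rmorphXn -!rmorphM.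
  split=> //.
  by rewrite m4 m2 !mulf_neq0.
have xk : comp k x = branch_comp k f by rewrite (comp_lift (xf _)) eqxx.
exists x; split=> [l lk||]; rewrite ?xk //.
rewrite (comp_lift (xf _)); case: eqP => [el|_]; last exact: rmorph0.
apply/branch_comp_eq0; rewrite /f /h (bigD1 l) ?lk ?el ?eqxx //= -mulrA mulrC.
by eexists.
Qed.

Lemma conductor_exists : exists n0 : nat, forall k n, (n0 <= n)%N ->
  exists x, [/\ forall l, l != k -> comp l x = 0,
                forall m, (m < n)%N -> comp k x m = 0 & comp k x n != 0].
Proof.
have [n0 hn0] := choice branch_conductor.
exists (\sum_k n0 k)%N => k n le_n; apply: hn0; apply: leq_trans le_n.
by rewrite (bigD1 k) //= leq_addr.
Qed.

(** If component k vanishes, [conductor_exists] gives a nonzero z supported on branch k, and x z =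
    0. The converse holds because the components lie in domains and jointly determine an element. *)
Lemma lreg_comp x : GRing.lreg x <-> forall k, comp k x != 0.
Proof.
split=> [rx k|x0 y z exyz].
  apply/eqP => xk; have [n0 /(_ k n0 (leqnn _))[z [zl _ zn]]] := conductor_exists.
  have z0 : z = 0.
    apply: rx; rewrite mulr0; apply: comp_inj => l; rewrite compM.
    by have [->|/zl->] := eqVneq l k; rewrite ?xk ?mul0r ?mulr0.
  by move: zn; rewrite z0 rmorph0 eqxx.
apply/subr0_eq/comp_inj => k; apply/eqP; have := x0 k.
have /eqP : comp k (x * (y - z)) = 0 by rewrite mulrBr exyz subrr rmorph0.
by rewrite compM mulf_eq0 => /orP[->|].
Qed.

Lemma fps_orderP (f : fps K) n : (forall m, (m < n)%N -> f m = 0) -> f n != 0 ->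
  fps_order f = n.
Proof.
move=> f0 fn; rewrite /fps_order; case: pselect => [h|[]]; last by exists n.
case: ex_minnP => m fm /(_ n fn) mn; apply/eqP; rewrite eqn_leq mn leqNgt.
by apply/negP => /f0; apply/eqP.
Qed.

Lemma hasval_value x a : hasval comp x a <-> GRing.lreg x /\ value C x = a.
Proof.
have val b : hasval comp x b -> value C x = b.
  by move=> [h0 hb]; apply/ffunP => k; rewrite ffunE; apply: fps_orderP; [exact: h0|exact: hb].
split=> [h|[/lreg_comp /hasval_ex[b hb] <-]]; last by rewrite (val b).
by split; [apply/lreg_comp => k; apply: hasval_neq0 h | apply: val].
Qed.

Lemma value_setE (Z : set R) a :
  value_set C Z a <-> exists2 x, Z x & hasval comp x a.
Proof.
split=> [[x [Zx rx vx]]|[x Zx /hasval_value[rx vx]]]; exists x => //.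
by apply/hasval_value.
Qed.

End Curve.

(** * Passage to the value semigroup of the curve *)

Lemma infinite_avoid (K : choiceType) : infinite_set [set: K]%classic ->
  forall s : seq K, exists x, x \notin s.
Proof.
move=> infK s; apply: contrapT => ns; apply: infK.
apply: sub_finite_set (finite_seq s) => x _ /=.
by apply/negPn/negP => xs; apply: ns; exists x.
Qed.

Unset Implicit Arguments.

Theorem theorem4p4 (K : fieldType) (hK : infinite_set [set: K]%classic)
    (R : comAlgType K) (c d : nat) (C : curve_product R c d)
    (omega : {ffun 'I_d -> nat})
    (homegaS : value_set C [set: R]%classic omega)
    (homega : forall i, (0 < omega i)%N)
    (F : R) (hFreg : GRing.lreg F) (hF : value C F = omega)
    (G : R) (hG : ~ exists r : R, G = F * r)
    (hR : forall x : R, span_upto F G (\sum_i omega i)%N.-1 x)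
    (i : nat) (hi : (i < \sum_k omega k)%N) :
  level (value_set C [set: R]%classic) omega i = value_set C (T_set C F G i).
Proof.
have infK := infinite_avoid hK.
have hFv : hasval (comp C) F omega by apply/hasval_value.
have gen x : exists (q : {poly K}) r,
    (size q <= \sum_k omega k)%N /\ x = horner_alg G q + F * r.
  have [q [r [sq ->]]] := span_upto_poly (hR x).
  by exists q, r; split=> //; rewrite (leq_trans sq) // prednK // (leq_ltn_trans _ hi).
have cond := conductor_exists C.
have -> : value_set C [set: R]%classic =
    [set a | exists x, hasval (comp C) x a]%classic.
  apply/seteqP; split=> a /=; first by move/value_setE => [x _ xa]; exists x.
  by move=> [x xa]; apply/value_setE; exists x.
rewrite (level_ell infK erefl hFv homega gen cond hi).
apply/seteqP; split=> a /=.
  case: i hi => [|j] hj ha; apply/value_setE => /=.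
    have [_ ->] := (apery0 erefl hFv homega gen a).1 ha.
    by exists 1; [exists 1; rewrite scale1r | exact: hasval1].
  have [ap ea] := ha.
  have [phi hphi hv] := apery_monic infK hFv homega ap ea.
  exists (G ^+ j.+1 + phi) => //; exists phi => //.
  have [rg vg] := (hasval_value _ _ _).1 hv; split=> // /value_setE.
  rewrite vg; apply: (apery_span_upto (gen := gen) ap); first by rewrite ea.
case: i hi => [|j] hj /value_setE[g].
  move=> [s ->] hv; apply/(apery0 erefl hFv homega gen); split=> //.
  (* A constant has no term of positive order, so its value is zero. *)
  apply/ffunP => k; rewrite ffunE; apply/eqP; rewrite -leqn0 leqNgt; apply/negP => ak.
  move/eqP: (hv.2 k); apply; rewrite leadZ /lead rmorph1.
  by case: (a k) ak => // m _; apply: mulr0.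
move=> [phi hphi [-> rg nv]] hv.
apply: (monic_apery infK hFv homega gen hphi hv).
by move=> /value_setE; have [_ <-] := (hasval_value _ _ _).1 hv.
Qed.
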